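(* Let $R$ be an exceptional prime ring with nonzero derivations $\delta,d$, and let $I$ be a nonzero ideal of $R$. (i) If $d$ is X-inner and $\delta$ is X-outer, then $\delta d([I,I])\subseteq Z(R)$ if and only if $d([R,R])\subseteq Z(R)$. (ii) If both $d$ and $\delta$ are X-inner, then $\delta d([I,I])\subseteq Z(R)$ if and only if either $d([R,R])\subseteq Z(R)$ or $\delta([R,R])\subseteq Z(R)$. (iii) If $d$ is X-outer and $\delta$ is X-inner, then $\delta d([I,I])\subseteq Z(R)$ if and only if $\delta([R,R])\subseteq Z(R)$. (iv) If both $\delta$ and $d$ are X-outer, then $\delta d([I,I])\subseteq Z(R)$ if and only if there exists $\beta\in Z(R)$ such that neither $d(\beta)=0$ nor $\delta(\beta)=0$, and $$\delta(\beta)d+d(\beta)\delta=\mathrm{ad}_g\quad\text{and}\quad d^2=\mu d+\mathrm{ad}_h$$ for some $g\in RC$, $h\in[RC,RC]$ and $\mu\in C$ such that $\mu=0$ if and only if $g\in[RC,RC]$, and if $\mu\neq 0$ then $g^2+\delta(\beta)\mu g\in C$.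
   Context: Rings are associative, not necessarily unital; $Z(R)$ is the center of $R$. $[a,b]:=ab-ba$; for additive subgroups $A,B$ of a ring, $AB$ (resp. $[A,B]$) is the additive subgroup generated by all $ab$ (resp. $[a,b]$), $a\in A$, $b\in B$. For a prime ring $R$, let $Q_s(R)$ be its Martindale symmetric ring of quotients and $C$ (the extended centroid) the center of $Q_s(R)$, which is a field; $RC$ is taken in $Q_s(R)$. A prime ring $R$ is called exceptional if both $\mathrm{char}\,R=2$ and $\dim_C RC=4$; in this case $RC$ is a central simple $C$-algebra (with $1$, so $C\subseteq RC$). A derivation of $R$ is an additive map $d\colon R\to R$ with $d(xy)=xd(y)+d(x)y$. Every derivation $d$ of $R$ extends uniquely to a derivation, also denoted $d$, of $Q_s(R)$, with $d(C)\subseteq C$ and $d(RC)\subseteq RC$. $\mathrm{ad}_a$ denotes the map $x\mapsto[a,x]$. A derivation $d$ of $R$ is X-inner if its extension to $Q_s(R)$ equals $\mathrm{ad}_a$ for some $a\in Q_s(R)$ (for exceptional $R$, $Q_s(R)=RC$), and X-outer otherwise. $\delta d$ and $d^2$ are compositions; identities between derivations are identities of maps on $RC$. *)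

(* Defs.v *)
From HB Require Import structures.
From mathcomp Require Import all_boot all_algebra.
From mathcomp Require Import classical_sets.

Set Implicit Arguments.
Unset Strict Implicit.
Unset Printing Implicit Defensive.

Import GRing.Theory.
Local Open Scope classical_set_scope.
Local Open Scope ring_scope.

(* Associative rings that need not have a unit; the MathComp hierarchy only
   has unital ones. *)
HB.mixin Record Zmodule_isRng R of GRing.Zmodule R := {
  rmul : R -> R -> R;
  rmulA : associative rmul;
  rmulDl : left_distributive rmul +%R;
  rmulDr : right_distributive rmul +%R
}.

#[short(type="rngType")]
HB.structure Definition Rng := {R of GRing.Zmodule R & Zmodule_isRng R}.

Reserved Notation "x ** y" (at level 40, left associativity).
Notation "x ** y" := (rmul x y) : ring_scope.

(* The rng underlying a unital ring, with [x ** y] convertible to [x * y]; this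
   lets the notions below apply both to R and to its quotient ring.  It is not
   declared canonical, as nzRingType does not inherit from rngType. *)
Definition rng_of (Q : nzRingType) : rngType :=
  HB.pack (GRing.NzRing.sort Q)
    (Zmodule_isRng.Build (GRing.NzRing.sort Q)
       (@mulrA Q) (@mulrDl Q) (@mulrDr Q)).

Definition add_subgroup (V : zmodType) (A : set V) : Prop :=
  A 0 /\ forall x y, A x -> A y -> A (x - y).

Section RngNotions.
Variable R : rngType.
Implicit Types (a x y : R) (A B I : set R) (d : R -> R).

Definition ad a : R -> R := fun x => a ** x - x ** a.

Definition prod_set A B : set R :=
  smallest (@add_subgroup R) [set a ** b | a in A & b in B].

Definition comm_set A B : set R :=
  smallest (@add_subgroup R) [set ad a b | a in A & b in B].

Definition rng_center : set R := [set z | forall x, z ** x = x ** z].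

Definition two_sided_ideal I : Prop :=
  add_subgroup I /\ forall x y, I y -> I (x ** y) /\ I (y ** x).

Definition nonzero_ideal I : Prop :=
  two_sided_ideal I /\ exists2 x, I x & x <> 0.

Definition prime_rng : Prop :=
  (exists x : R, x <> 0) /\
  forall a b, (forall x, a ** x ** b = 0) -> a = 0 \/ b = 0.

(* Without a unit the characteristic is the least positive n with nR = 0. *)
Definition rng_pchar (n : nat) : Prop :=
  [/\ (0 < n)%N, forall x : R, x *+ n = 0 &
      forall m, (0 < m < n)%N -> exists x : R, x *+ m <> 0].

Definition derivation d : Prop :=
  (forall x y, d (x + y) = d x + d y) /\
  (forall x y, d (x ** y) = x ** d y + d x ** y).

End RngNotions.

Arguments rng_center : clear implicits.

(* [iota] presents Q as the Martindale symmetric ring of quotients of the prime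
   ring R.  These properties (Passman; Beidar-Martindale-Mikhalev) determine
   (Q, iota) up to a unique isomorphism over R: Q is the ring of classes of
   compatible pairs (f, g), defined on nonzero ideals J, of a right R-module map
   f : J -> R and a left R-module map g : J -> R.  Maps on J are given as
   functions on R of which only the values on J matter. *)
Record symmetric_quotient_ring (R : rngType) (Q : nzRingType)
    (iota : R -> Q) : Prop := SymmetricQuotientRing {
  sqr_inj : injective iota;
  sqr_add : {morph iota : x y / x + y >-> x + y};
  sqr_mul : {morph iota : x y / x ** y >-> x * y};
  sqr_denom : forall q : Q, exists2 J : set R, nonzero_ideal J &
    forall x, J x -> range iota (q * iota x) /\ range iota (iota x * q);
  sqr_faithful : forall (q : Q) (J : set R), nonzero_ideal J ->
    (forall x, J x -> q * iota x = 0) \/ (forall x, J x -> iota x * q = 0) ->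
    q = 0;
  sqr_complete : forall (J : set R) (f g : R -> R), nonzero_ideal J ->
    (forall x y, J x -> J y -> f (x + y) = f x + f y) ->
    (forall x y, J x -> J y -> g (x + y) = g x + g y) ->
    (forall x r, J x -> f (x ** r) = f x ** r) ->
    (forall x r, J x -> g (r ** x) = r ** g x) ->
    (forall x y, J x -> J y -> g x ** y = x ** f y) ->
    exists q : Q, forall x, J x ->
      q * iota x = iota (f x) /\ iota x * q = iota (g x)
}.

Definition extended_centroid (Q : nzRingType) : set Q := rng_center (rng_of Q).
Arguments extended_centroid : clear implicits.

Definition central_closure (R : rngType) (Q : nzRingType) (iota : R -> Q) :
    set Q :=
  @prod_set (rng_of Q) (range iota) (extended_centroid Q).

(* [V] has an n-element basis over the commutative subring [C] of Q. *)
Definition has_dim_over (Q : nzRingType) (C V : set Q) (n : nat) : Prop :=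
  exists e : 'I_n -> Q,
    [/\ forall i, V (e i),
        forall v, V v -> exists c : 'I_n -> Q,
          (forall i, C (c i)) /\ v = \sum_(i < n) c i * e i &
        forall c : 'I_n -> Q, (forall i, C (c i)) ->
          \sum_(i < n) c i * e i = 0 -> forall i, c i = 0].

Definition exceptional (R : rngType) (Q : nzRingType) (iota : R -> Q) : Prop :=
  [/\ prime_rng R, rng_pchar R 2 &
      has_dim_over (extended_centroid Q) (central_closure iota) 4].

(* [dQ] is the extension to Q of the derivation [d] of R; there is exactly one
   when Q is the symmetric ring of quotients of R. *)
Definition extends_derivation (R : rngType) (Q : nzRingType) (iota : R -> Q)
    (d : R -> R) (dQ : Q -> Q) : Prop :=
  @derivation (rng_of Q) dQ /\ forall x, dQ (iota x) = iota (d x).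

Definition X_inner (Q : nzRingType) (dQ : Q -> Q) : Prop :=
  exists a : Q, forall q, dQ q = @ad (rng_of Q) a q.

(* Main.v *)
(* Write A for RC and L for [A, A].  Over the field C, the algebra A is a quaternion algebra
   in characteristic 2 and has a basis 1, e, u, v with [e,u] = u, [e,v] = v, [u,v] = 1.
   The reduced trace t and the polar form b of the reduced norm satisfy
     [x, y] = t(x) y + t(y) x + b(x, y),   x^2 + t(x) x in C,   L = ker t,
   and t commutes with derivations.  Nonzero ideals of R meet C nontrivially, so Q_s(R) = A,
   and since derivations kill squares of central elements, the condition on [I, I] is
   equivalent to delta d (L) <= C.

   On L one has ad_a(x) = t(a) x modulo C, which settles the cases with an inner derivation,
   because a derivation mapping L into C is ad_a with t(a) = 0.  When both are outer, expand
   delta d (cx) for c in C, x in L: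
     delta(d c) x + d(c) delta(x) + delta(c) d(x) in C.
   This gives c with d(c), delta(c) both nonzero, and shows that delta(c) d + d(c) delta kills
   C, hence is some ad_g, with t(g) = delta(d c).  Substituting d x for x shows that
   d^2 + mu d maps L into C for mu = t(g) / delta(c), hence is ad_h with t(h) = 0. *)

Require Import Defs.
From HB Require Import structures.
From mathcomp Require Import all_boot all_algebra.
From mathcomp Require Import boolp classical_sets.

Set Implicit Arguments.
Unset Strict Implicit.
Unset Printing Implicit Defensive.

Import GRing.Theory.
Local Open Scope classical_set_scope.
Local Open Scope ring_scope.

Lemma smallest_ind (T : Type) (K : set T -> Prop) (G P : set T) :
  K P -> (forall x, G x -> P x) -> forall x, smallest K G x -> P x.
Proof. by move=> KP GP x; apply; split. Qed.

Definition br (Q : nzRingType) (x y : Q) : Q := x * y - y * x.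

(** * Brackets and spans over the centroid *)

Section Centre.
Variable Q : nzRingType.
Implicit Types (c x y z : Q) (s : seq Q).
Local Notation C := (extended_centroid Q).

Lemma centC c x : C c -> c * x = x * c. Proof. exact. Qed.

Lemma centP c : (forall x, c * x = x * c) -> C c. Proof. exact. Qed.

Lemma cent0 : C 0. Proof. by move=> x; exact: etrans (mul0r (x : Q)) (esym (mulr0 _)). Qed.

Lemma cent1 : C 1. Proof. by move=> x; exact: etrans (mul1r (x : Q)) (esym (mulr1 _)). Qed.

Lemma centD x y : C x -> C y -> C (x + y).
Proof.
by move=> Cx Cy; apply: centP => z; rewrite mulrDl mulrDr (centC _ Cx) (centC _ Cy).
Qed.

Lemma centN x : C x -> C (- x).
Proof. by move=> Cx; apply: centP => z; rewrite mulNr mulrN (centC _ Cx). Qed.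

Lemma centB x y : C x -> C y -> C (x - y).
Proof. by move=> Cx Cy; apply: centD => //; apply: centN. Qed.

Lemma centM x y : C x -> C y -> C (x * y).
Proof.
by move=> Cx Cy; apply: centP => z; rewrite -mulrA (centC z Cy) !mulrA (centC z Cx).
Qed.

Lemma centAC c x y : C c -> x * (c * y) = c * (x * y).
Proof. by move=> Cc; rewrite !mulrA (centC x Cc). Qed.

Lemma brDl x y z : br (x + y) z = br x z + br y z.
Proof. by rewrite /br mulrDl mulrDr opprD addrACA. Qed.

Lemma brDr x y z : br x (y + z) = br x y + br x z.
Proof. by rewrite /br mulrDl mulrDr opprD addrACA. Qed.

Lemma brMr x y z : br x (y * z) = br x y * z + y * br x z.
Proof. by rewrite /br mulrBl mulrBr !mulrA addrA subrK. Qed.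

Lemma brZl c x y : C c -> br (c * x) y = c * br x y.
Proof. by move=> Cc; rewrite /br mulrBr centAC ?mulrA. Qed.

Lemma brZr c x y : C c -> br x (c * y) = c * br x y.
Proof. by move=> Cc; rewrite /br mulrBr centAC ?mulrA. Qed.

Lemma brxx x : br x x = 0. Proof. by rewrite /br subrr. Qed.

Lemma brx0 x : br x 0 = 0. Proof. by rewrite /br mulr0 mul0r subrr. Qed.

Lemma br0x x : br 0 x = 0. Proof. by rewrite /br mulr0 mul0r subrr. Qed.

Lemma brNr x y : br x (- y) = - br x y.
Proof. by rewrite /br mulrN mulNr opprB opprK addrC. Qed.

Lemma brNl x y : br (- x) y = - br x y.
Proof. by rewrite /br mulrN mulNr opprB opprK addrC. Qed.

Lemma brBr x y z : br x (y - z) = br x y - br x z.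
Proof. by rewrite brDr brNr. Qed.

Lemma brBl x y z : br (x - y) z = br x z - br y z.
Proof. by rewrite brDl brNl. Qed.

Lemma brxC x c : C c -> br x c = 0.
Proof. by move=> Cc; rewrite /br (centC _ Cc) subrr. Qed.

Lemma brCx x c : C c -> br c x = 0.
Proof. by move=> Cc; rewrite /br (centC _ Cc) subrr. Qed.

Lemma br_cent x : (forall y, br x y = 0) -> C x.
Proof. by move=> x0; apply: centP => y; apply/eqP; rewrite -subr_eq0; apply/eqP/x0. Qed.

Definition subspace (P : Q -> Prop) : Prop :=
  [/\ P 0, forall x y, P x -> P y -> P (x + y) & forall c x, C c -> P x -> P (c * x)].

Lemma subspaceB P x y : subspace P -> P x -> P y -> P (x - y).
Proof.
move=> [P0 PD PZ] Px Py; apply: PD => //; rewrite -mulN1r; apply: PZ => //.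
exact/centN/cent1.
Qed.

(** The intersection of all subspaces containing [s]; applying a proof of [span s x] to a predicate
    is span induction. *)
Definition span (s : seq Q) (x : Q) : Prop :=
  forall P, subspace P -> (forall a, a \in s -> P a) -> P x.

Lemma span_subspace s : subspace (span s).
Proof.
split=> [P [] //|x y sx sy P PP sP|c x Cc sx P PP sP]; case: (PP) => P0 PD PZ.
  by apply: PD; [apply: sx | apply: sy].
by apply: PZ => //; apply: sx.
Qed.

Lemma span0 s : span s 0. Proof. by case: (span_subspace s). Qed.

Lemma span_mem s a : a \in s -> span s a.
Proof. by move=> sa P _; apply. Qed.

Lemma span_sub s1 s2 : {subset s1 <= s2} -> forall x, span s1 x -> span s2 x.
Proof.
by move=> s12 x; apply; [apply: span_subspace | move=> a /s12; apply: span_mem].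
Qed.

Lemma span_nil x : span [::] x -> x = 0.
Proof.
move=> s0; apply: (s0 (fun y => y = 0)) => //.
by split=> // [y z -> ->|c y _ ->]; rewrite ?addr0 ?mulr0.
Qed.

Lemma span_cons a s x : span (a :: s) x <-> exists2 c, C c & span s (x - c * a).
Proof.
have [S0 SD SZ] := span_subspace s; split=> [|[c Cc sx]].
  move=> sx; apply: (sx (fun y => exists2 c, C c & span s (y - c * a))) => [|b].
  split.
  - by exists 0; [exact: cent0 | rewrite mul0r subr0].
  - move=> x1 y [c Cc sx1] [c' Cc' sy]; exists (c + c'); first exact: centD.
    by rewrite mulrDl opprD addrACA; apply: SD.
  - move=> k y Ck [c Cc sy]; exists (k * c); first exact: centM.
    by rewrite -mulrA -mulrBr; apply: SZ.
  rewrite inE => /orP[/eqP->|sb].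
    by exists 1; [exact: cent1 | rewrite mul1r subrr].
  by exists 0; [exact: cent0 | rewrite mul0r subr0; apply: span_mem].
have [S0' SD' SZ'] := span_subspace (a :: s).
rewrite -(subrK (c * a) x); apply: SD'; last first.
  by apply: SZ' => //; apply: span_mem; apply: mem_head.
by apply: span_sub sx => b sb; rewrite inE sb orbT.
Qed.

Lemma span1 a x : span [:: a] x -> exists2 c, C c & x = c * a.
Proof. by case/span_cons => c Cc /span_nil/eqP; rewrite subr_eq0 => /eqP->; exists c. Qed.

Lemma span2 a b x : span [:: a; b] x ->
  exists c1 c2, [/\ C c1, C c2 & x = c1 * a + c2 * b].
Proof.
case/span_cons=> c1 C1 /span1[c2 C2 /eqP]; rewrite subr_eq addrC => /eqP->.
by exists c1, c2.
Qed.

Lemma span3 a b c x : span [:: a; b; c] x ->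
  exists c1 c2 c3, [/\ C c1, C c2, C c3 & x = c1 * a + c2 * b + c3 * c].
Proof.
case/span_cons=> c1 C1 /span2[c2 [c3 [C2 C3 /eqP]]].
by rewrite subr_eq addrC addrA => /eqP->; exists c1, c2, c3.
Qed.

Lemma span4 a b c d x : span [:: a; b; c; d] x ->
  exists c1 c2 c3 c4, [/\ C c1, C c2, C c3 & C c4] /\
    x = c1 * a + c2 * b + c3 * c + c4 * d.
Proof.
case/span_cons=> c1 C1 /span3[c2 [c3 [c4 [C2 C3 C4 /eqP]]]].
by rewrite subr_eq addrC !addrA => /eqP->; exists c1, c2, c3, c4.
Qed.

Hypothesis C_field : forall c, C c -> c <> 0 -> exists2 c', C c' & c' * c = 1.

Lemma cent_cancel c x : C c -> c <> 0 -> c * x = 0 -> x = 0.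
Proof. by move=> Cc /(C_field Cc)[c' _ c'c] cx; rewrite -(mul1r x) -c'c -mulrA cx mulr0. Qed.

Lemma cent_divl c x : C c -> c <> 0 -> C (c * x) -> C x.
Proof.
move=> Cc /(C_field Cc)[c' Cc' c'c] Ccx.
by rewrite -(mul1r x) -c'c -mulrA; apply: centM.
Qed.

(** Steinitz exchange, with [s0] the elements already fixed. Induction on [s]: if its head has a
    nonzero coefficient in [y], then [y] replaces it; otherwise the head is kept and the exchange
    happens further on. *)
Lemma span_exchange s0 s y : span (s0 ++ s) y -> ~ span s0 y ->
  exists2 s', size s = (size s').+1 &
    forall v, span (s0 ++ s) v -> span (y :: s0 ++ s') v.
Proof.
elim: s => [|a s IHs] in s0 *; first by rewrite cats0.
have catE v : span (s0 ++ a :: s) v <-> span (a :: s0 ++ s) v.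
  by split; apply: span_sub => b; rewrite !(inE, mem_cat); do ?case: eqP; rewrite ?orbT.
move=> /catE/span_cons[c Cc sy] s0y; have [c0|c_neq0] := pselect (c = 0).
  rewrite c0 mul0r subr0 in sy; have [s' ss' s'P] := IHs _ sy s0y.
  exists (a :: s') => /= [|v]; first by rewrite ss'.
  move=> /catE/span_cons[c' Cc' /s'P sv].
  suff: span (a :: y :: s0 ++ s') v.
    by apply: span_sub => b; rewrite !(inE, mem_cat); do ?case: eqP; rewrite ?orbT.
  by apply/span_cons; exists c'.
exists s => // v /catE sv; apply: sv (span_subspace _) _ => b.
have [S0 SD SZ] := span_subspace (y :: s0 ++ s).
rewrite inE => /orP[/eqP->|sb]; last by apply: span_mem; rewrite inE sb orbT.
have [c' Cc' c'c] := C_field Cc c_neq0.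
have ->: a = c' * (y - (y - c * a)) by rewrite subKr mulrA c'c mul1r.
apply: SZ => //; apply: (subspaceB (span_subspace _)).
  by apply: span_mem; apply: mem_head.
by apply: span_sub sy => b' sb'; rewrite inE sb' orbT.
Qed.

(** Three exchanges replace three of the four generators, and [w] is the survivor. The last three
    hypotheses state linear independence one vector at a time. *)
Lemma span_extend3 (V : Q -> Prop) s y1 y2 y3 : size s = 4%N ->
  (forall x, V x -> span s x) -> V y1 -> V y2 -> V y3 ->
  y1 <> 0 -> ~ span [:: y1] y2 -> ~ span [:: y2; y1] y3 ->
  exists w, forall x, V x -> span [:: y3; y2; y1; w] x.
Proof.
move=> s4 Vs V1 V2 V3 n1 n2 n3.
have [|s1] := @span_exchange [::] s y1 (Vs _ V1); first by move/span_nil.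
rewrite s4 => -[s1_3] s1P.
have [s2] := @span_exchange [:: y1] s1 y2 (s1P _ (Vs _ V2)) n2.
rewrite -s1_3 => -[s2_2] s2P.
have [s3] := @span_exchange [:: y2; y1] s2 y3 (s2P _ (s1P _ (Vs _ V3))) n3.
rewrite -s2_2; case: s3 => [//|w []//] _ s3P.
by exists w => x /Vs/s1P/s2P/s3P.
Qed.
End Centre.

(** * Prime algebras spanned by four elements *)

Section PrimeSubalgebra.
Variables (Q : nzRingType) (V : Q -> Prop) (s : seq Q).
Implicit Types (c x y z : Q).
Local Notation C := (extended_centroid Q).
Hypothesis C_field : forall c, C c -> c <> 0 -> exists2 c', C c' & c' * c = 1.
Hypothesis V_subspace : subspace V.
Hypothesis V_mul : forall x y, V x -> V y -> V (x * y).
Hypothesis V_prime : forall a b,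
  (forall w, V w -> a * w * b = 0) -> a = 0 \/ b = 0.
Hypothesis V_cent : forall x, (forall w, V w -> br x w = 0) -> C x.
Hypothesis size_s : size s = 4%N.
Hypothesis V_span : forall x, V x -> span s x.

Let V0 : V 0. Proof. by case: V_subspace. Qed.
Let VD x y : V x -> V y -> V (x + y). Proof. by case: V_subspace => _ + _; apply. Qed.
Let VZ c x : C c -> V x -> V (c * x). Proof. by case: V_subspace => _ _; apply. Qed.
Let VB x y : V x -> V y -> V (x - y). Proof. exact: subspaceB. Qed.
Let Vbr x y : V x -> V y -> V (br x y).
Proof. by move=> Vx Vy; apply: VB; apply: V_mul. Qed.

Lemma ncent_br x : ~ C x -> exists2 w, V w & br x w <> 0.
Proof.
move=> nCx; apply: contrapT => nw; apply/nCx/V_cent => w Vw.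
by apply: contrapT => xw; apply: nw; exists w.
Qed.

(* If ad_x has rank one with image C u, then [x, wx] = [x, w]x shows ux = au with a
   central; so [x, v](x - a) = 0 for all v, and primeness gives [x, V] = 0 or x = a. *)
Lemma ad_rank1_cent x u :
  V x -> (forall v, V v -> exists2 c, C c & br x v = c * u) -> C x.
Proof.
move=> Vx rk; apply: contrapT => nCx; have [w Vw xw] := ncent_br nCx.
have [k Ck ke] := rk _ Vw; have k0 : k <> 0 by move=> k0; rewrite ke k0 mul0r in xw.
have [k' Ck' k'k] := C_field Ck k0.
have [l Cl le] := rk _ (V_mul Vw Vx).
rewrite brMr brxx mulr0 addr0 ke -mulrA in le.
have {le} ux : u * x = k' * l * u by rewrite -mulrA -le mulrA k'k mul1r.
set a := k' * l in ux; have Ca : C a by apply: centM.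
have kill v : V v -> br x v * (x - a) = 0.
  move=> Vv; have [c Cc ->] := rk _ Vv.
  by rewrite -mulrA mulrBr ux (centC u Ca) subrr mulr0.
have [//|/eqP] : br x w = 0 \/ x - a = 0.
  apply: V_prime => z Vz.
  have := kill _ (V_mul Vw Vz).
  by rewrite brMr mulrDl -(mulrA w) (kill z) // mulr0 addr0.
by rewrite subr_eq0 => /eqP xa; apply: nCx; rewrite xa.
Qed.

(** Were [y] independent of [y1] and [y2], these three and some [w] would span [V]; then ad_x would
    have image in C [x, w], and [ad_rank1_cent] would make [x] central. *)
Lemma centraliser_span x y1 y2 y : V x -> ~ C x ->
  V y1 -> V y2 -> V y -> br x y1 = 0 -> br x y2 = 0 -> br x y = 0 ->
  y1 <> 0 -> ~ span [:: y1] y2 -> span [:: y2; y1] y.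
Proof.
move=> Vx nCx V1 V2 Vy x1 x2 xy n1 n2; apply: contrapT => n3; apply: nCx.
have [w wP] := span_extend3 C_field size_s V_span V1 V2 Vy n1 n2 n3.
apply: (@ad_rank1_cent x (br x w)) => // v /wP/span4.
move=> [c1 [c2 [c3 [c4 [[C1 C2 C3 C4] ->]]]]]; exists c4 => //.
by rewrite !brDr !brZr // x1 x2 xy !mulr0 !add0r.
Qed.

Lemma span_unit x : span [:: 1] x -> C x.
Proof. by case/span1 => c Cc ->; rewrite mulr1. Qed.

Lemma V_sandwich x y : x <> 0 -> y <> 0 -> exists2 w, V w & x * w * y <> 0.
Proof.
move=> x0 y0; apply: contrapT => nw; case: (@V_prime x y) => // w Vw.
by apply: contrapT => xwy; apply: nw; exists w.
Qed.

(** If all squares vanished, elements of [V] would anticommute and x y x = 0, against primeness. So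
    some z = x^2 is nonzero, with z^2 = 0. Sandwiching (v + z)^3 = 0 between two [z] gives z v z v z
    = 0; linearising in [v] yields (z v z) w (z v z) = 0, again against primeness. *)
Lemma V_not_nil3 : ~ (forall x, V x -> x * x * x = 0).
Proof.
move=> nil3.
have [x Vx xx] : exists2 x, V x & x * x <> 0.
  apply: contrapT => nx.
  have nil2 x : V x -> x * x = 0.
    by move=> Vx; apply: contrapT => xx; apply: nx; exists x.
  have one0 : (1 : Q) <> 0 by apply/eqP; rewrite oner_eq0.
  have [x Vx] := V_sandwich one0 one0; rewrite mul1r mulr1 => x0.
  have [y Vy] := V_sandwich x0 x0; apply.
  have /eqP := nil2 _ (VD Vx Vy).
  rewrite mulrDl !mulrDr !nil2 // add0r addr0 addr_eq0 => /eqP->.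
  by rewrite mulNr -mulrA nil2 // mulr0 oppr0.
set z := x * x in xx; have Vz : V z by apply: V_mul.
have zz : z * z = 0 by rewrite {1}/z mulrA nil3 // mul0r.
clearbody z.
have zvz v : V v -> z * v * z * v * z = 0.
  move=> Vv; have := nil3 _ (VD Vv Vz) => /(congr1 (fun y => z * y * z)).
  have zl : z * (v + z) = z * v by rewrite mulrDr zz addr0.
  have zr : (v + z) * z = v * z by rewrite mulrDl zz addr0.
  rewrite mulr0 mul0r -!mulrA zr !mulrA zl mulrDr mulrDl mulrDl => <-.
  by rewrite -(mulrA z v v) -(mulrA z _ v) nil3 // mulr0 mul0r add0r.
have zvzwz v w : V v -> V w -> z * v * z * w * z = - (z * w * z * v * z).
  move=> Vv Vw; apply/eqP; rewrite -addr_eq0; apply/eqP.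
  have := zvz _ (VD Vv Vw).
  by rewrite !(mulrDr, mulrDl) !zvz // add0r addr0 addrC.
have [v Vv zvz0] := V_sandwich xx xx.
have [w Vw] := V_sandwich zvz0 zvz0; apply.
have -> : z * v * z * w * (z * v * z) = z * v * z * w * z * v * z by rewrite !mulrA.
rewrite zvzwz // !mulNr.
have -> : z * w * z * v * z * v * z = z * w * (z * v * z * v * z) by rewrite !mulrA.
by rewrite zvz // mulr0 oppr0.
Qed.

(* If 1 is not in V, then V meets C in 0, so centralisers of nonzero elements have
   dimension at most 2.  Hence x, x^2, x^3 are dependent; as V is not nil, this gives an
   idempotent f.  Its centraliser is spanned by f and an idempotent g of (1-f)V(1-f),
   and primeness forces f + g = 1. *)
Lemma V_unit : V 1.
Proof.
apply: contrapT => nV1.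
have nC x : V x -> x <> 0 -> ~ C x.
  by move=> Vx x0 Cx; have [c Cc cx] := C_field Cx x0; apply: nV1; rewrite -cx; apply: VZ.
have cube x : V x -> exists a b, [/\ C a, C b & x * x * x = a * (x * x) + b * x].
  move=> Vx; have [->|x0] := pselect (x = 0).
    by exists 0, 0; rewrite !mul0r addr0; split=> //; apply: cent0.
  have [|n2] := pselect (span [:: x] (x * x)).
    move=> /span1[c Cc xx]; exists c, 0; split=> //; first exact: cent0.
    by rewrite {1}xx -mulrA mul0r addr0.
  have Vxx := V_mul Vx Vx.
  have xxx : br x (x * x) = 0 by rewrite brMr brxx mul0r mulr0 addr0.
  have := centraliser_span Vx (nC _ Vx x0) Vx Vxx (V_mul Vxx Vx) (brxx x) xxx.
  rewrite brMr brxx xxx mul0r mulr0 addr0 => /(_ erefl x0 n2)/span2.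
  by move=> [a [b [Ca Cb ->]]]; exists a, b.
have [f [Vf f0 ff]] : exists f, [/\ V f, f <> 0 & f * f = f].
  apply: contrapT => nf; apply: V_not_nil3 => x Vx; apply: contrapT => x3.
  have [a [b [Ca Cb xE]]] := cube _ Vx; apply: nf.
  have [b0|b0] := pselect (b = 0).
    rewrite b0 mul0r addr0 in xE.
    have a0 : a <> 0 by move=> a0; apply: x3; rewrite xE a0 mul0r.
    have [a' Ca' a'a] := C_field Ca a0.
    (* Here x^3 = a x^2, so y = x / a satisfies y^3 = y^2 and y^2 is idempotent. *)
    pose y := a' * x; have Vy : V y by apply: VZ.
    have yyE : y * y = a' * (a' * (x * x)) by rewrite /y -mulrA (centAC _ _ Ca').
    have yyy : y * y * y = y * y.
      rewrite [RHS]yyE {1}yyE -!mulrA /y !(centAC x _ Ca') (mulrA x x x) xE.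
      by rewrite (mulrA a' a) a'a mul1r.
    exists (y * y); split; first exact: V_mul.
      move=> yy0; apply: x3; rewrite xE; rewrite yyE in yy0.
      have a'0 : a' <> 0 by move=> a'0; move/eqP: a'a; rewrite a'0 mul0r eq_sym oner_eq0.
      by rewrite (cent_cancel C_field Ca' a'0 (cent_cancel C_field Ca' a'0 yy0)) mulr0.
    by rewrite mulrA yyy yyy.
  have [b' Cb' b'b] := C_field Cb b0.
  (* Solving x^3 = a x^2 + b x for the last term gives x f = x; as [f] is a polynomial in [x]
     without constant term, f f = f. *)
  pose f := b' * (x * x - a * x).
  have xf : x * f = x.
    rewrite /f (centAC _ _ Cb') mulrBr (centAC _ _ Ca) (mulrA x x x) xE.
    by rewrite addrC addKr mulrA b'b mul1r.
  exists f; split.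
  - by apply: VZ => //; apply: VB; [apply: V_mul | apply: VZ].
  - by move=> f0; apply: x3; rewrite -[X in _ * X]xf f0 !mulr0.
  - by rewrite {1}/f -mulrA mulrBl -!mulrA xf.
(* The complementary idempotent lies only in [Q], but the corner pVp is still contained in [V]. *)
pose p := 1 - f.
have pf : p * f = 0 by rewrite mulrBl mul1r ff subrr.
have fp : f * p = 0 by rewrite mulrBr mulr1 ff subrr.
have pp : p * p = p by rewrite {1}/p mulrBl mul1r fp subr0.
have p0 : p <> 0 by move/eqP; rewrite subr_eq0 => /eqP f1; rewrite f1 in nV1.
have Vp w : V w -> V (p * w * p).
  move=> Vw; rewrite /p mulrBl mul1r mulrBr mulr1.
  by apply: VB; [apply: VB | apply: V_mul]; rewrite ?mulrBl //; do ?apply: VB; do ?apply: V_mul.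
have fpw w : f * (p * w * p) = 0 by rewrite !mulrA fp !mul0r.
have pwf w : p * w * p * f = 0 by rewrite -mulrA pf mulr0.
have [w0 Vw0] := V_sandwich p0 p0; set g0 := p * w0 * p => g0_neq0.
have Vg0 : V g0 by apply: Vp.
have fg0 : f * g0 = 0 by apply: fpw.
(* The corner commutes with [f], so it lies in C f + C g0; multiplying by [f] kills the first
   coefficient. *)
have corner w : V w -> exists2 c, C c & p * w * p = c * g0.
  move=> Vw; have n2 : ~ span [:: f] g0.
    move=> /span1[c Cc cf]; apply: g0_neq0; have /(congr1 (fun y => f * y)) := cf.
    by rewrite fg0 (centAC _ _ Cc) ff -cf.
  have fC y : f * y = 0 -> y * f = 0 -> br f y = 0.
    by rewrite /br => -> ->; rewrite subrr.
  have := centraliser_span Vf (nC _ Vf f0) Vf Vg0 (Vp _ Vw) (brxx f)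
    (fC _ fg0 (pwf _)) (fC _ (fpw _) (pwf _)) f0 n2.
  move=> /span2[c1 [c2 [C1 C2 wE]]]; exists c1 => //.
  have := congr1 (fun y => f * y) wE.
  rewrite fpw mulrDr (centAC _ _ C1) (centAC _ _ C2) fg0 ff mulr0 add0r wE => <-.
  by rewrite addr0.
have pg0 : p * g0 = g0 by rewrite /g0 !mulrA pp.
have g0p : g0 * p = g0 by rewrite /g0 -!mulrA pp.
have [c Cc g0g0] : exists2 c, C c & g0 * g0 = c * g0.
  have Vw : V (w0 * p * w0).
    by rewrite mulrBr mulr1 mulrBl; apply: VB; do ?apply: V_mul.
  have [c Cc cE] := corner _ Vw; exists c => //; rewrite -cE.
  have -> : p * (w0 * p * w0) * p = p * w0 * (p * p) * w0 * p by rewrite pp !mulrA.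
  by rewrite /g0 !mulrA.
have [w Vw gwg] := V_sandwich g0_neq0 g0_neq0.
(* If g0^2 = 0, then g0 V g0 = g0 (pVp) g0 is contained in C g0^3 = 0, against primeness. *)
have c0 : c <> 0.
  move=> c0; apply: gwg; rewrite -{1}g0p -{2}pg0.
  have -> : g0 * p * w * (p * g0) = g0 * (p * w * p) * g0 by rewrite !mulrA.
  by have [k Ck ->] := corner _ Vw; rewrite (centAC _ _ Ck) g0g0 c0 mul0r mulr0 mul0r.
have [c' Cc' c'c] := C_field Cc c0.
pose g := c' * g0.
have g0E : g0 = c * g by rewrite /g mulrA (centC _ Cc) c'c mul1r.
have gg : g * g = g by rewrite /g -mulrA (centAC _ _ Cc') g0g0 (mulrA c' c) c'c mul1r.
have pg : p * g = g by rewrite /g (centAC _ _ Cc') pg0.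
have gp : g * p = g by rewrite /g -mulrA g0p.
suff : p - g = 0 \/ p - g = 0.
  by case=> /eqP; rewrite subr_eq0 => /eqP pgE; apply: nV1;
    rewrite -(subrK f 1) -/p pgE; apply: VD => //; apply: VZ.
(* As pVp = C g, the product (p - g) v (p - g) is a multiple of (1 - g) g (1 - g) = 0. Hence p = g
   lies in [V], and so does 1 = p + f. *)
apply: V_prime => v Vv.
have -> : (p - g) * v * (p - g) = (1 - g) * (p * v * p) * (1 - g).
  have gl : (1 - g) * p = p - g by rewrite mulrBl mul1r gp.
  have gr : p * (1 - g) = p - g by rewrite mulrBr mulr1 pg.
  by rewrite -{1}gl -gr !mulrA.
have [k Ck ->] := corner _ Vv.
by rewrite g0E (centAC _ _ Ck) (centAC _ _ Cc) mulrBl mul1r gg subrr !mulr0 mul0r.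
Qed.

(** * The quaternion basis in characteristic 2 *)

Hypothesis char2 : forall x : Q, x + x = 0.
Hypothesis V_noncentral : exists2 x, V x & ~ C x.

Let add_eq0 x y : x + y = 0 -> x = y.
Proof. by move=> xy; apply: (addIr y); rewrite xy char2. Qed.

Let sub_add x y : x - y = x + y.
Proof. by congr (_ + _); apply: (addrI y); rewrite subrr char2. Qed.

Let brA x y : br x y = br y x.
Proof. by rewrite /br !sub_add addrC. Qed.

Lemma br_sqr x y : br (x * x) y = br x (br x y).
Proof.
by rewrite brA brMr (brA y x) [RHS]/br sub_add addrC.
Qed.

Lemma centraliser2 x y : V x -> ~ C x -> V y -> br x y = 0 -> span [:: x; 1] y.
Proof.
move=> Vx nCx Vy xy; apply: (centraliser_span Vx nCx V_unit Vx Vy) => //.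
- exact/brxC/cent1.
- exact: brxx.
- by apply/eqP; rewrite oner_eq0.
- by move/span_unit.
Qed.

(** If all squares were central, then ad_x^2 = 0 on [V]. So [x, y] commutes with [x] and lies in C x
    + C; bracketing with [y] puts it in [C]. The same applied to [x y] makes [x, y] x central, hence
    [x] too. *)
Lemma square_noncentral : exists2 x, V x & ~ C (x * x).
Proof.
apply: contrapT => nsq.
have sqC x : V x -> C (x * x) by move=> Vx; apply: contrapT => xx; apply: nsq; exists x.
have brbr x y : V x -> br x (br x y) = 0.
  by move=> Vx; rewrite -br_sqr brCx //; apply: sqC.
have brC x y : V x -> ~ C x -> V y -> br x y <> 0 -> C (br x y).
  move=> Vx nCx Vy xy0.
  have /span2[c1 [c2 [C1 C2 kE]]] := centraliser2 Vx nCx (Vbr Vx Vy) (brbr _ y Vx).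
  rewrite kE mulr1; suff -> : c1 = 0 by rewrite mul0r add0r.
  apply: contrapT => c10; apply: xy0; apply: (cent_cancel C_field C1 c10).
  have := brbr y x Vy; rewrite (brA y x) {1}kE mulr1 brDr brZr // (brxC _ C2) addr0.
  by rewrite (brA y x).
have [x Vx nCx] := V_noncentral; have [y Vy xy0] := ncent_br nCx.
have Ck := brC _ _ Vx nCx Vy xy0.
have xxy : br x (x * y) = br x y * x by rewrite brMr brxx mul0r add0r (centC _ Ck).
apply: (nCx); apply: (cent_divl C_field Ck xy0); rewrite -xxy.
apply: brC => //; first exact: V_mul.
rewrite xxy => /(cent_cancel C_field Ck xy0) x0.
by apply: xy0; rewrite x0 br0x.
Qed.

(** A noncentral square gives x^2 = t x + n with [t] nonzero, and e = x / t satisfies ad_e^2 = ad_e.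
    Two independent eigenvectors of eigenvalue 1 have a nonzero scalar bracket, and rescaling one
    makes it 1. *)
Lemma sl2_basis : exists e u v, [/\ V e, V u & V v] /\
  [/\ br e u = u, br e v = v, br u v = 1 &
      forall x, V x -> span [:: 1; e; u; v] x].
Proof.
have [x Vx nCxx] := square_noncentral.
have nCx : ~ C x by move=> Cx; apply: nCxx; apply: centM.
have /span2[t [n [Ct Cn xxE]]] : span [:: x; 1] (x * x).
  by apply: centraliser2 => //; [apply: V_mul | rewrite brMr brxx mul0r mulr0 addr0].
have t0 : t <> 0.
  by move=> t0; apply: nCxx; rewrite xxE t0 mul0r add0r mulr1.
have [t' Ct' t't] := C_field Ct t0.
pose e := t' * x; have Ve : V e by apply: VZ.
have ade y : br e (br e y) = br e y.
  rewrite /e !(brZl _ _ Ct') (brZr _ _ Ct') -br_sqr xxE mulr1 brDl (brCx _ Cn) addr0.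
  by rewrite (brZl _ _ Ct) (mulrA t' t) t't mul1r.
have nCe : ~ C e.
  move=> Ce; apply/nCx/(cent_divl C_field Ct') => // t'0.
  by move/eqP: t't; rewrite t'0 mul0r eq_sym oner_eq0.
have [y Vy u0] := ncent_br nCe; set u := br e y in u0.
have eu : br e u = u by apply: ade.
have Vu : V u by apply: Vbr.
have nCu : ~ C u by move=> Cu; apply: u0; rewrite -eu brxC.
(* Otherwise the image of ad_e is C u, and [ad_rank1_cent] makes [e] central. *)
have [v0 [Vv0 ev0 uv0]] : exists v, [/\ V v, br e v = v & ~ span [:: u] v].
  apply: contrapT => nv; apply/nCe/(@ad_rank1_cent e u) => // z Vz.
  apply: contrapT => nz; apply: nv; exists (br e z); split; [exact: Vbr | exact: ade |].
  by move=> /span1[c Cc ze]; apply: nz; exists c.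
have e_eigen0 z : br e z = 0 -> br e z = z -> z = 0 by move=> <-.
(* The square commutes with [e], since [u, [u, e]] = [u, u] = 0, so it lies in C e + C; it commutes
   with [u], which kills the coefficient of [e]. *)
have uu : C (u * u).
  have := br_sqr u e; rewrite (brA u e) eu brxx => uue.
  have /span2[c1 [c2 [C1 C2 uuE]]] : span [:: e; 1] (u * u).
    by apply: centraliser2 => //; [apply: V_mul | rewrite brA].
  have c1u : c1 * u = 0.
    rewrite -eu (brA e u) -brZr // -[RHS](brxx (u : Q)).
    have : br u (u * u) = 0 by rewrite brMr brxx mul0r mulr0 addr0.
    by rewrite uuE mulr1 brDr (brxC _ C2) addr0 brxx.
  have [c10|/(cent_cancel C_field C1)] := pselect (c1 = 0); last by move/(_ _ c1u)/u0.
  by rewrite uuE c10 mul0r add0r mulr1.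
(* Eigenvalues of ad_e add under brackets, and 1 + 1 = 0. *)
have : br e (br u v0) = 0.
  by rewrite {2}/br brBr !brMr eu ev0 !char2 subrr.
move=> euv; have := centraliser2 Ve nCe (Vbr Vu Vv0) euv.
move=> /span2[c1 [k [C1 Ck uvE]]].
have c10 : c1 = 0.
  apply: contrapT => /(cent_cancel C_field C1) c10; apply/u0/c10.
  have := br_sqr u v0; rewrite uvE mulr1 brDr brZr // (brxC _ Ck) addr0 (brA u e) eu.
  by rewrite brCx.
rewrite c10 mul0r add0r mulr1 in uvE.
(* Otherwise [v0] centralises [u], so it lies in C u + C; applying ad_e puts it in C u. *)
have k0 : k <> 0.
  move=> k0; apply: uv0; rewrite k0 in uvE.
  have /span2[p [q [Cp Cq vE]]] := centraliser2 Vu nCu Vv0 uvE.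
  apply/span_cons; exists p => //; rewrite -ev0 vE brDr brZr // eu mulr1 (brxC _ Cq).
  by rewrite addr0 subrr; exact: span0.
have [k' Ck' k'k] := C_field Ck k0.
exists e, u, (k' * v0); split; split=> //; first exact: VZ.
- by rewrite brZr // ev0.
- by rewrite brZr // uvE.
have n2 : ~ span [:: 1] e by move/span_unit.
have n3 : ~ span [:: e; 1] u.
  move=> /span2[p [q [Cp Cq uE]]]; apply: u0; rewrite -eu uE mulr1 brDr brZr // brxx.
  by rewrite mulr0 (brxC _ Cq) addr0.
have one0 : (1 : Q) <> 0 by apply/eqP; rewrite oner_eq0.
have [w wP] := span_extend3 C_field size_s V_span V_unit Ve Vu one0 n2 n3.
have n4 : ~ span [:: u; e; 1] v0.
  move=> /span3[p [q [r [Cp Cq Cr vE]]]]; apply: uv0.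
  apply/span_cons; exists p => //; rewrite -ev0 vE mulr1 !brDr.
  rewrite (brZr _ _ Cp) (brZr _ _ Cq) (brxC _ Cr).
  by rewrite eu brxx mulr0 !addr0 subrr; exact: span0.
have [[|//] _ vP] := @span_exchange _ C_field [:: u; e; 1] [:: w] v0 (wP _ Vv0) n4.
move=> z /wP/vP; apply; first exact: span_subspace.
have [S0 SD SZ] := span_subspace [:: 1; e; u; k' * v0].
move=> a; rewrite cats0 !inE => /orP[/eqP->|].
  have {2}-> : v0 = k * (k' * v0) by rewrite mulrA (centC _ Ck) k'k mul1r.
  by apply: (SZ _ _ Ck); apply: span_mem; rewrite !inE eqxx !orbT.
by case/or3P => /eqP->; apply: span_mem; rewrite !inE eqxx ?orbT.
Qed.

End PrimeSubalgebra.

(** * Derivations *)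

Section Derivations.
Variables (Q : nzRingType) (D : Q -> Q).
Local Notation C := (extended_centroid Q).
Hypothesis D_der : @derivation (rng_of Q) D.

Lemma derD x y : D (x + y) = D x + D y. Proof. exact: D_der.1. Qed.

Lemma derM x y : D (x * y) = x * D y + D x * y. Proof. exact: D_der.2. Qed.

Lemma der0 : D 0 = 0. Proof. by apply: (addIr (D 0)); rewrite -derD !add0r. Qed.

Lemma derN x : D (- x) = - D x.
Proof. by apply: (addIr (D x)); rewrite -derD !addNr der0. Qed.

Lemma der1 : D 1 = 0.
Proof. by apply: (addIr (D 1)); rewrite add0r -{3}(mulr1 1) derM mulr1 mul1r. Qed.

Lemma der_sub x y : D (x - y) = D x - D y.
Proof. by rewrite derD derN. Qed.

Lemma der_br x y : D (br x y) = br (D x) y + br x (D y).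
Proof.
by rewrite /br derD derN !derM [x * D y + _]addrC opprD addrACA.
Qed.

Lemma der_cent c : C c -> C (D c).
Proof.
move=> Cc; apply: br_cent => y.
by have := der_br c y; rewrite !(brCx _ Cc) der0 addr0 => <-.
Qed.

End Derivations.

Section DerivationConstructions.
Variable Q : nzRingType.
Implicit Types (x y : Q) (D : Q -> Q).
Local Notation C := (extended_centroid Q).
Local Notation der := (@derivation (rng_of Q)).

Lemma ad_der a : der (br a).
Proof. by split=> x y; [exact: brDr | rewrite addrC; exact: brMr]. Qed.

Lemma addf_der D1 D2 : der D1 -> der D2 -> der (fun x => D1 x + D2 x).
Proof.
move=> d1 d2; split=> x y; first by rewrite (derD d1) (derD d2) addrACA.
rewrite [LHS](congr2 +%R (derM d1 x y) (derM d2 x y)) addrACA.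
by congr (_ + _); [exact: esym (mulrDr _ _ _) | exact: esym (mulrDl _ _ _)].
Qed.

Lemma scalef_der c D : C c -> der D -> der (fun x => c * D x).
Proof.
move=> Cc d; split=> x y; first by rewrite (derD d) mulrDr.
rewrite [LHS](congr1 _ (derM d x y)) mulrDr; congr (_ + _).
  exact: esym (centAC _ _ Cc).
exact: mulrA.
Qed.

(** The cross term of the Leibniz rule is 2 D(x) D(y) = 0. *)
Lemma sqrf_der D : (forall x, x + x = 0) -> der D -> der (fun x => D (D x)).
Proof.
move=> char2 d; split=> x y; first by rewrite !(derD d).
rewrite [LHS](congr1 D (derM d x y)) (derD d) !(derM d) -addrA.
by rewrite (addrA (D x * D y)) char2 add0r.
Qed.

Lemma der_sqr_scale D c x : (forall y : Q, y + y = 0) -> der D -> C c ->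
  D (c * c * x) = c * c * D x.
Proof.
by move=> char2 d Cc; rewrite (derM d) (derM d c c) (centC (D c) Cc) char2 mul0r addr0.
Qed.

End DerivationConstructions.

(** * Quaternion algebras in characteristic 2 *)

Section Quaternion.
Variables (Q : nzRingType) (e u v : Q).
Implicit Types (c x y z : Q) (D : Q -> Q).
Local Notation C := (extended_centroid Q).
Hypothesis C_field : forall c, C c -> c <> 0 -> exists2 c', C c' & c' * c = 1.
Hypothesis char2 : forall x : Q, x + x = 0.
Hypotheses (br_eu : br e u = u) (br_ev : br e v = v) (br_uv : br u v = 1).

Let add_eq0 x y : x + y = 0 -> x = y.
Proof. by move=> xy; apply: (addIr y); rewrite xy char2. Qed.

Let addKK x y : x + (x + y) = y. Proof. by rewrite addrA char2 add0r. Qed.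

Let brA x y : br x y = br y x.
Proof. by apply: add_eq0; rewrite /br addrA subrK subrr. Qed.

(** Reading coordinates by brackets shows that an ideal containing [x] contains [c2], [c3] and
    [c4]. *)
Lemma sl2_coords c1 c2 c3 c4 x : C c1 -> C c2 -> C c3 -> C c4 ->
  x = c1 * 1 + c2 * e + c3 * u + c4 * v ->
  [/\ br v (br e x) = c3, br u (br e x) = c4 & br v (br u x) = c2].
Proof.
move=> C1 C2 C3 C4 ->; rewrite mulr1.
have -> : br e (c1 + c2 * e + c3 * u + c4 * v) = c3 * u + c4 * v.
  rewrite !brDr (brxC _ C1) (brZr _ _ C2) (brZr _ _ C3) (brZr _ _ C4).
  by rewrite brxx mulr0 !add0r br_eu br_ev.
have -> : br u (c1 + c2 * e + c3 * u + c4 * v) = c2 * u + c4.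
  rewrite !brDr (brxC _ C1) (brZr _ _ C2) (brZr _ _ C3) (brZr _ _ C4).
  by rewrite brxx mulr0 add0r addr0 (brA u e) br_eu br_uv mulr1.
rewrite !brDr !(brZr _ _ C2, brZr _ _ C3, brZr _ _ C4) (brA v u) br_uv !brxx.
by rewrite (brxC _ C4) !mulr0 !mulr1 !addr0 add0r.
Qed.

Hypothesis Q_span : forall x, span [:: 1; e; u; v] x.

Lemma brC2 x y : br x y = x * y + y * x.
Proof. by congr (_ + _); apply: add_eq0; rewrite addNr. Qed.

(* The reduced trace, read off in the basis 1, e, u, v as the coefficient of e. *)
Definition trd x : Q := br u (br v x).

(* The polar form of the reduced norm. *)
Definition bform x y : Q := br x y + (trd x * y + trd y * x).

Lemma trdD x y : trd (x + y) = trd x + trd y.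
Proof. by rewrite /trd !brDr. Qed.

Lemma trdZ c x : C c -> trd (c * x) = c * trd x.
Proof. by move=> Cc; rewrite /trd !brZr. Qed.

Lemma trd_cent c : C c -> trd c = 0.
Proof. by move=> Cc; rewrite /trd (brxC _ Cc) brx0. Qed.

Lemma trd_u : trd u = 0.
Proof. by rewrite /trd (brA v u) br_uv; apply/brxC/cent1. Qed.

Lemma trd_v : trd v = 0. Proof. by rewrite /trd brxx brx0. Qed.

Lemma trd_e : trd e = 1. Proof. by rewrite /trd (brA v e) br_ev. Qed.

Lemma trdC x : C (trd x).
Proof.
apply: (Q_span x) (fun y => C (trd y)) _ _.
  split=> [|y z Cy Cz|c y Cc Cy]; first by rewrite trd_cent; apply: cent0.
    by rewrite trdD; apply: centD.
  by rewrite trdZ //; apply: centM.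
move=> a; rewrite !inE => /orP[/eqP->|/or3P[]/eqP->].
- by rewrite trd_cent; [apply: cent0 | apply: cent1].
- by rewrite trd_e; apply: cent1.
- by rewrite trd_u; apply: cent0.
- by rewrite trd_v; apply: cent0.
Qed.

Lemma bformC x y : bform x y = bform y x.
Proof. by rewrite /bform brA [trd x * y + _]addrC. Qed.

Lemma bformDr x y z : bform x (y + z) = bform x y + bform x z.
Proof.
rewrite /bform brDr trdD (mulrDr (trd x)) (mulrDl (trd y)).
by rewrite (addrACA (trd x * y)) (addrACA (br x y)).
Qed.

Lemma bformZr c x y : C c -> bform x (c * y) = c * bform x y.
Proof.
move=> Cc; rewrite /bform (brZr _ _ Cc) (trdZ _ Cc) (centAC (trd x) _ Cc).
by rewrite (mulrDr c (br x y)) (mulrDr c (trd x * y)) (mulrA c (trd y)).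
Qed.

Lemma bform_cent x c : C c -> bform x c = c * trd x.
Proof.
by move=> Cc; rewrite /bform (brxC _ Cc) (trd_cent Cc) mul0r addr0 add0r (centC _ Cc).
Qed.

Lemma bform_span_cent x : (forall a, a \in [:: e; u; v] -> C (bform x a)) ->
  forall y, C (bform x y).
Proof.
move=> xC y; apply: (Q_span y) (fun z => C (bform x z)) _ _.
  split=> [|y1 z Cy Cz|c y1 Cc Cy].
  - by rewrite bform_cent ?mul0r; apply: cent0.
  - by rewrite bformDr; apply: centD.
  - by rewrite bformZr //; apply: centM.
move=> a; rewrite inE => /orP[/eqP->|/xC//].
by rewrite bform_cent ?mul1r; [apply: trdC | apply: cent1].
Qed.

Lemma bform_xx x : bform x x = 0.
Proof. by rewrite /bform brxx add0r char2. Qed.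

Lemma bform_eu : bform e u = 0.
Proof. by rewrite /bform br_eu trd_u trd_e mul0r mul1r addr0 char2. Qed.

Lemma bform_ev : bform e v = 0.
Proof. by rewrite /bform br_ev trd_v trd_e mul0r mul1r addr0 char2. Qed.

Lemma bform_uv : bform u v = 1.
Proof. by rewrite /bform br_uv trd_v trd_u !mul0r !addr0. Qed.

(** By bilinearity it suffices to take basis elements: the form is alternating, its value against 1
    is the trace, and only b(u, v) = 1 remains. *)
Lemma bform_is_cent x y : C (bform x y).
Proof.
apply: bform_span_cent => a; rewrite !inE bformC => /or3P[]/eqP->;
  apply: bform_span_cent => b; rewrite !inE => /or3P[]/eqP->;
  rewrite ?bform_xx ?(bformC u e) ?(bformC v e) ?(bformC v u);
  rewrite ?bform_eu ?bform_ev ?bform_uv; do ?exact: cent0; exact: cent1.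
Qed.

Lemma brE x y : br x y = trd x * y + trd y * x + bform x y.
Proof. by rewrite /bform addrC -addrA char2 addr0. Qed.

Lemma trd_br x y : trd (br x y) = 0.
Proof.
rewrite brE 2!trdD (trdZ y (trdC x)) (trdZ x (trdC y)) (trd_cent (bform_is_cent x y)).
by rewrite addr0 (centC _ (trdC x)) char2.
Qed.

(** In characteristic 2, [x^2, y] = [x, [x, y]]; expanding the inner bracket by [brE] leaves t(x)
    [x, y]. *)
Lemma sqr_trd x : C (x * x + trd x * x).
Proof.
apply: br_cent => y; rewrite brDl (brZl _ _ (trdC x)).
have -> : br (x * x) y = br x (br x y).
  by rewrite brA brMr (brA y x) [RHS]brC2 addrC.
rewrite [in X in X + _](brE x y) 2!brDr (brZr _ _ (trdC x)) (brZr _ _ (trdC y)) brxx.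
by rewrite mulr0 addr0 (brxC _ (bform_is_cent x y)) addr0 char2.
Qed.

Lemma mul_u_cent c : C c -> C (c * u) -> c = 0.
Proof.
move=> Cc Ccu; have := brxC e Ccu; rewrite (brZr _ _ Cc) br_eu => cu.
by rewrite -(mulr1 c) -br_uv -(brZl _ _ Cc) cu br0x.
Qed.

(** Applying [D] to the central element x^2 + t(x) x and expanding [x, D x] by [brE] shows that (t(D
    x) + D(t(x))) x is central. For noncentral [x] the coefficient vanishes. *)
Lemma der_trd D x : @derivation (rng_of Q) D -> trd (D x) = D (trd x).
Proof.
move=> d; have [Cx|nCx] := pselect (C x).
  by rewrite (trd_cent Cx) (trd_cent (der_cent d Cx)) (der0 d).
apply: add_eq0; apply: contrapT => n0; apply: nCx.
apply: (cent_divl C_field _ n0).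
  by apply: centD; [|apply: (der_cent d)]; apply: trdC.
have -> : (trd (D x) + D (trd x)) * x = D (x * x + trd x * x) + bform x (D x).
  rewrite (derD d (x * x)) (derM d x x) (derM d (trd x) x) -brC2 (brE x (D x)).
  rewrite (mulrDl (trd (D x))).
  move: (bform x _) (trd x * D x) (trd (D x) * x) (D (trd x) * x) => b p q r.
  by rewrite [RHS](AC (3*2*1) ((1*4)*(2*5)*(3*6)))%AC /= !char2 add0r addr0.
by apply: centD; [apply/(der_cent d)/sqr_trd | apply: bform_is_cent].
Qed.

Lemma trd0_span x : trd x = 0 ->
  exists c1 c2 c3, [/\ C c1, C c2, C c3 & x = c1 * u + c2 * v + c3].
Proof.
move=> tx; have [c1 [c2 [c3 [c4 [[C1 C2 C3 C4] xE]]]]] := span4 (Q_span x).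
move: tx; rewrite xE !trdD (trdZ _ C1) (trdZ _ C2) (trdZ _ C3) (trdZ _ C4).
rewrite (trd_cent (@cent1 Q)) trd_e trd_u trd_v !mulr0 mulr1 !addr0 add0r => ->.
exists c3, c4, c1; split=> //; rewrite mulr1 mul0r addr0 -addrA addrC.
by rewrite -addrA.
Qed.

Lemma br_trd0 a x : trd x = 0 -> br a x = trd a * x + bform a x.
Proof. by move=> tx; rewrite brE tx mul0r addr0. Qed.

Lemma trd_uv : trd (u * v) = 1.
Proof. by rewrite /trd (brMr v u v) brxx mulr0 addr0 (brA v u) br_uv mul1r. Qed.

(** * Derivations of the quaternion algebra *)

Local Notation der D := (@derivation (rng_of Q) D).

(* The kernel L of trd is spanned by 1, u, v, and Q = L + C uv since trd (uv) = 1. *)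
Lemma der_ext D1 D2 : der D1 -> der D2 -> (forall c, C c -> D1 c = D2 c) ->
  D1 u = D2 u -> D1 v = D2 v -> D1 =1 D2.
Proof.
move=> d1 d2 eqC equ eqv.
have eqM x y : D1 x = D2 x -> D1 y = D2 y -> D1 (x * y) = D2 (x * y).
  by move=> ex ey; rewrite (derM d1) (derM d2) ex ey.
have eqL x : trd x = 0 -> D1 x = D2 x.
  move=> /trd0_span[c1 [c2 [c3 [C1 C2 C3 ->]]]].
  rewrite !(derD d1) !(derD d2) (eqC _ C3).
  by rewrite (eqM _ _ (eqC _ C1) equ) (eqM _ _ (eqC _ C2) eqv).
move=> x; rewrite -(addKK (trd x * (u * v)) x) (derD d1) (derD d2); congr (_ + _).
  by apply: (eqM _ _ (eqC _ (trdC x))); apply: eqM.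
by apply: eqL; rewrite trdD (trdZ _ (trdC x)) trd_uv mulr1 char2.
Qed.

(** The map x -> D x + eps x fails to be linear on c u by exactly D(c) u, which is therefore
    central. *)
Lemma der_lin_cent D eps : der D -> C eps ->
  (forall x, trd x = 0 -> C (D x + eps * x)) -> forall c, C c -> D c = 0.
Proof.
move=> d Ce DL c Cc; apply: mul_u_cent; first exact: der_cent.
have tcu : trd (c * u) = 0 by rewrite (trdZ _ Cc) trd_u mulr0.
have -> : D c * u = (D (c * u) + eps * (c * u)) + c * (D u + eps * u).
  rewrite (derM d) mulrDr (centAC c _ Ce) (centAC eps _ Cc) mulrA (centC eps Cc) -mulrA.
  move: (c * D u) (D c * u) (c * (eps * u)) => p q r.
  by rewrite [RHS](AC (3*2) ((1*4)*(3*5)*2))%AC /= !char2 !add0r.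
by apply: centD; [apply: DL | apply: centM => //; apply/DL/trd_u].
Qed.

Lemma der_trd0_cent D : der D -> (forall x, trd x = 0 -> C (D x)) ->
  exists2 a, trd a = 0 & D =1 br a.
Proof.
move=> d DL.
have DC c : C c -> D c = 0.
  apply: (der_lin_cent d (@cent0 Q)) => x /DL; by rewrite mul0r addr0.
have [CDu CDv] : C (D u) /\ C (D v) by split; apply: DL; [apply: trd_u | apply: trd_v].
(* [D] kills [C], and D u, D v are central; with [u, v] = 1 this element brackets [u] to D u and [v]
   to D v. *)
exists (D u * v + D v * u).
  by rewrite trdD (trdZ _ CDu) (trdZ _ CDv) trd_u trd_v !mulr0 addr0.
apply: der_ext => //; first exact: ad_der.
- by move=> c Cc; rewrite DC // brxC.
- by rewrite brDl (brZl _ _ CDu) (brZl _ _ CDv) brxx (brA v) br_uv mulr0 mulr1 addr0.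
- by rewrite brDl (brZl _ _ CDu) (brZl _ _ CDv) brxx br_uv mulr0 mulr1 add0r.
Qed.

(** Since u^2 is central, D u commutes with [u], so D u = k u modulo [C]; likewise for [v], and D
    [u, v] = 0 makes the two coefficients equal. Adding the bracket with k e removes them and leaves
    a derivation covered by [der_trd0_cent]. *)
Lemma der_inner D : der D -> (forall c, C c -> D c = 0) -> exists a, D =1 br a.
Proof.
move=> d DC.
have DL x : trd x = 0 -> trd (D x) = 0 by move=> tx; rewrite (der_trd _ d) tx (der0 d).
have DZ c x : C c -> D (c * x) = c * D x.
  by move=> Cc; rewrite (derM d) (DC _ Cc) mul0r addr0.
have uu : br u (D u) = 0.
  rewrite brC2 -(derM d) DC //.
  by have := sqr_trd u; rewrite trd_u mul0r addr0.
have vv : br v (D v) = 0.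
  rewrite brC2 -(derM d) DC //.
  by have := sqr_trd v; rewrite trd_v mul0r addr0.
have [k [p2 [p3 [Ck P2 P3 DuE]]]] := trd0_span (DL _ trd_u).
have [q1 [q2 [q3 [Q1 Q2 Q3 DvE]]]] := trd0_span (DL _ trd_v).
have p20 : p2 = 0.
  move: uu; rewrite DuE !brDr (brZr _ _ Ck) (brZr _ _ P2) brxx br_uv (brxC _ P3).
  by rewrite mulr0 mulr1 add0r addr0.
have q10 : q1 = 0.
  move: vv; rewrite DvE !brDr (brZr _ _ Q1) (brZr _ _ Q2) brxx (brA v) br_uv (brxC _ Q3).
  by rewrite mulr0 mulr1 !addr0.
rewrite p20 mul0r addr0 in DuE; rewrite q10 mul0r add0r in DvE.
have kq : k = q2.
  apply: add_eq0; have := der_br d u v; rewrite br_uv (der1 d) DuE DvE brDl brDr.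
  by rewrite (brZl _ _ Ck) (brZr _ _ Q2) br_uv !mulr1 (brCx _ P3) (brxC _ Q3) !addr0.
have [||a _ aE] := @der_trd0_cent (fun x => D x + br (k * e) x).
- by apply: addf_der => //; apply: ad_der.
- move=> x /trd0_span[c1 [c2 [c3 [C1 C2 C3 ->]]]].
  have -> : D (c1 * u + c2 * v + c3) + br (k * e) (c1 * u + c2 * v + c3) =
      c1 * p3 + c2 * q3.
    rewrite (derD d (c1 * u + c2 * v)) (derD d (c1 * u)) !DZ // (DC c3) // DuE DvE -kq !brDr.
    rewrite (brxC _ C3) !addr0 !(brZl _ _ Ck) (brZr _ _ C1) (brZr _ _ C2) br_eu br_ev.
    rewrite (centAC k _ C1) (centAC k _ C2) !mulrDr.
    move: (c1 * _) (c1 * _) (c2 * _) (c2 * _) => p q r s.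
    by rewrite [LHS](AC ((2*2)*2) ((1*5)*(3*6)*(2*4)))%AC /= !char2 !add0r.
  by apply: centD; apply: centM.
exists (a + k * e) => x; rewrite brDl -aE -addrA char2 addr0 //.
Qed.

Lemma ad_cancel a y : trd a <> 0 -> trd y = 0 -> C (br a y) -> C y.
Proof.
move=> ta ty; rewrite (br_trd0 _ ty) => Cay; apply: (cent_divl C_field (trdC a) ta).
rewrite -(addKK (bform a y) (trd a * y)); apply: centD; first exact: bform_is_cent.
by rewrite addrC.
Qed.

(** * Compositions of two derivations on trace-zero elements *)

Section TwoDerivations.
Variables dl d : Q -> Q.
Hypotheses (dl_der : der dl) (d_der : der d).
Let comp_cent := forall x, trd x = 0 -> C (dl (d x)).
Let cent_on_sl (D : Q -> Q) := forall x, trd x = 0 -> C (D x).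
Let inner (D : Q -> Q) := exists a, D =1 br a.

Lemma comp_cent_l : cent_on_sl dl -> comp_cent.
Proof. by move=> H x tx; apply: H; rewrite (der_trd _ d_der) tx (der0 d_der). Qed.

Lemma comp_cent_r : cent_on_sl d -> comp_cent.
Proof. by move=> H x tx; apply/(der_cent dl_der)/H. Qed.

Lemma ad_on_sl D a : D =1 br a -> trd a = 0 -> cent_on_sl D.
Proof.
by move=> Da ta x tx; rewrite Da (br_trd0 _ tx) ta mul0r add0r; apply: bform_is_cent.
Qed.

(** Modulo [C], [dl] multiplies trace-zero elements by t(a); a nonzero t(a) can be cancelled. *)
Lemma comp_inner_l : inner dl -> comp_cent -> cent_on_sl dl \/ cent_on_sl d.
Proof.
move=> [a dla] H; have [ta|ta] := pselect (trd a = 0); first by left; apply: ad_on_sl ta.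
right=> x tx; apply: (ad_cancel ta); last by rewrite -dla; apply: H.
by rewrite (der_trd _ d_der) tx (der0 d_der).
Qed.

Lemma comp_inner_r : inner d -> comp_cent -> cent_on_sl d \/ cent_on_sl dl.
Proof.
move=> [a da] H; have [ta|ta] := pselect (trd a = 0); first by left; apply: ad_on_sl ta.
(* With b = 1 / t(a), d(b y) equals [y] modulo [C], and [dl] preserves [C]. *)
right=> y ty; have [b Cb ba] := C_field (trdC a) ta.
have tby : trd (b * y) = 0 by rewrite (trdZ _ Cb) ty mulr0.
have := H _ tby; rewrite da (br_trd0 _ tby) mulrA (centC _ (trdC a)) ba mul1r.
rewrite (derD dl_der) => Cy.
rewrite -(addKK (dl (bform a (b * y))) (dl y)); apply: centD; last by rewrite addrC.
exact/(der_cent dl_der)/bform_is_cent.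
Qed.

Lemma comp_scale c x : comp_cent -> C c -> trd x = 0 ->
  C (d c * dl x + (dl c * d x + dl (d c) * x)).
Proof.
move=> H Cc tx; have tcx : trd (c * x) = 0 by rewrite (trdZ _ Cc) tx mulr0.
have := centD (H _ tcx) (centM Cc (H _ tx)).
rewrite (derM d_der) (derD dl_der) (derM dl_der c) (derM dl_der (d c)).
move: (c * _) (dl c * _) (d c * _) (dl (d c) * _) => p q r s.
by rewrite (AC ((2*2)*1) ((1*5)*(3*(2*4))))%AC /= char2 add0r.
Qed.

Lemma scaled_lin D c0 eps : der D -> C c0 -> c0 <> 0 -> C eps ->
  (forall x, trd x = 0 -> C (c0 * D x + eps * x)) -> forall c, C c -> D c = 0.
Proof.
move=> dD C0 c0_neq0 Ce H c Cc; apply: (cent_cancel C_field C0 c0_neq0).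
exact: (der_lin_cent (scalef_der C0 dD) Ce H).
Qed.

Lemma outer_not_lin D : der D -> ~ inner D -> exists2 c, C c & D c <> 0.
Proof.
move=> dD nD; apply: contrapT => nc; apply/nD/(der_inner dD) => c Cc.
by apply: contrapT => Dc; apply: nc; exists c.
Qed.

(** Any [c1] with d(c1) nonzero works: if dl(c1) = 0, [comp_scale] makes d(c1) dl(x) + dl(d(c1)) x
    central for trace-zero [x], which forces [dl] to vanish on [C] and hence to be inner. *)
Lemma outer_common_cent : ~ inner dl -> ~ inner d -> comp_cent ->
  exists2 c, C c & d c <> 0 /\ dl c <> 0.
Proof.
move=> ndl nd H; have [c1 C1 dc1] := outer_not_lin d_der nd; exists c1 => //; split=> // dlc1.
have [c Cc] := outer_not_lin dl_der ndl; apply.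
apply: (scaled_lin dl_der (der_cent d_der C1) dc1 (eps := dl (d c1))) => //.
  by do 2?apply: der_cent.
move=> x tx; have := comp_scale H C1 tx.
by rewrite dlc1 mul0r add0r.
Qed.

Section FixedScalar.
Variable beta : Q.
Hypotheses (C_beta : C beta) (d_beta : d beta <> 0) (dl_beta : dl beta <> 0).

Let Cdb : C (d beta). Proof. exact: der_cent. Qed.
Let Cdlb : C (dl beta). Proof. exact: der_cent. Qed.

Lemma comp_cent_relations : comp_cent ->
  exists g h mu, [/\ trd h = 0, C mu &
    [/\ forall x, dl beta * d x + d beta * dl x = br g x,
        forall x, d (d x) = mu * d x + br h x,
        mu = 0 <-> trd g = 0 &
        C (g * g + dl beta * mu * g)]].
Proof.
move=> H; set eps := dl (d beta).
have Ceps : C eps by apply: der_cent.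
have D_der := addf_der (scalef_der Cdlb d_der) (scalef_der Cdb dl_der).
have Deps x : trd x = 0 -> C (dl beta * d x + d beta * dl x + eps * x).
  by move=> tx; have := comp_scale H C_beta tx; rewrite addrA [_ * dl x + _]addrC.
have [g gE] := der_inner D_der (der_lin_cent D_der Ceps Deps).
(* Modulo [C], [g, u] is t(g) u, while [Deps] gives eps u. *)
have tg : trd g = eps.
  apply: add_eq0; apply: mul_u_cent; first by apply: centD => //; apply: trdC.
  have := Deps _ trd_u; rewrite gE (br_trd0 _ trd_u) => Cu.
  have -> : (trd g + eps) * u = trd g * u + bform g u + eps * u + bform g u.
    by rewrite mulrDl [RHS](AC (3*1) ((1*3)*(2*4)))%AC /= char2 addr0.
  by apply: centD => //; apply: bform_is_cent.
have [al' Cal' alK] := C_field Cdlb dl_beta.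
pose mu := al' * eps; have Cmu : C mu by apply: centM.
have almu : dl beta * mu = eps by rewrite /mu mulrA (centC _ Cdlb) alK mul1r.
have E_der := addf_der (sqrf_der char2 d_der) (scalef_der Cmu d_der).
have [x tx|h th hE] := der_trd0_cent E_der.
  (* Evaluating the relation for [g] at d x expresses dl(beta) (d^2 x + mu d x) through dl(d x) and
     a central term. *)
  apply: (cent_divl C_field Cdlb dl_beta).
  have tdx : trd (d x) = 0 by rewrite (der_trd _ d_der) tx (der0 d_der).
  have := gE (d x); rewrite (br_trd0 _ tdx) tg => gdx.
  have -> : dl beta * (d (d x) + mu * d x) = d beta * dl (d x) + bform g (d x).
    rewrite mulrDr (mulrA _ mu) almu; apply: add_eq0.
    by rewrite (AC (2*2) (1*3*(2*4)))%AC /= gdx char2.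
  by apply: centD; [apply: centM => //; apply: H | apply: bform_is_cent].
exists g, h, mu; split=> //; split=> // [x||].
- by rewrite -hE [RHS]addrC -addrA char2 addr0.
- rewrite tg; split=> [mu0|eps0]; last by rewrite /mu eps0 mulr0.
  by rewrite -almu mu0 mulr0.
- by rewrite almu -tg; apply: sqr_trd.
Qed.

Lemma relations_comp_cent g h mu : trd h = 0 -> C mu ->
  (forall x, dl beta * d x + d beta * dl x = br g x) ->
  (forall x, d (d x) = mu * d x + br h x) ->
  (mu = 0 <-> trd g = 0) ->
  (mu <> 0 -> C (g * g + dl beta * mu * g)) -> comp_cent.
Proof.
move=> th Cmu gE hE mu0 muC x tx.
(* For nonzero [mu], adding the two quadratic relations for [g] makes (t(g) + dl(beta) mu) g
   central. A nonzero coefficient would make [g] central, so t(g) = 0 and mu = 0. *)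
have tg : trd g = dl beta * mu.
  have [m0|m0] := pselect (mu = 0); first by rewrite (mu0.1 m0) m0 mulr0.
  apply: add_eq0; apply: contrapT => n0; apply: (m0); apply/mu0/trd_cent.
  apply: (cent_divl C_field _ n0).
    by apply: centD; [apply: trdC | apply: centM].
  have -> : (trd g + dl beta * mu) * g =
      (g * g + trd g * g) + (g * g + dl beta * mu * g).
    by rewrite mulrDl addrACA char2 add0r.
  by apply: centD; [apply: sqr_trd | apply: muC].
apply: (cent_divl C_field Cdb d_beta).
have tdx : trd (d x) = 0 by rewrite (der_trd _ d_der) tx (der0 d_der).
have := gE (d x); rewrite hE (br_trd0 _ tdx) (br_trd0 _ tx) th mul0r add0r tg => gdx.
have -> : d beta * dl (d x) = dl beta * bform h x + bform g (d x).
  by move: gdx; rewrite mulrDr mulrA -addrA => /addrI <-; rewrite addKK.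
by apply: centD; [apply: centM => // |]; apply: bform_is_cent.
Qed.

End FixedScalar.
End TwoDerivations.

Lemma br_br_cent x y z w : C (br (br x y) (br z w)).
Proof.
by rewrite (br_trd0 _ (trd_br z w)) trd_br mul0r add0r; apply: bform_is_cent.
Qed.

Lemma comm_set_trd x :
  @comm_set (rng_of Q) setT setT x <-> trd x = 0.
Proof.
split.
  apply: (smallest_ind (P := fun y => trd y = 0)) => [|_ [a _ [b _ <-]]]; last exact: trd_br.
  split=> [|y z]; first by rewrite /trd !brx0.
  move=> ty tz; have -> : (y - z : Q) = y + z.
    by congr (_ + _); apply: add_eq0; rewrite addNr.
  by rewrite /= trdD ty tz addr0.
move=> tx P [[P0 PB] Pbr].
have brP y z : P (br y z) by apply: Pbr; exists y => //; exists z.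
(* As t(e) = 1 and t(x) = 0, [e, x] is x + b(e, x), and the scalar is itself a bracket because
   [u, v] = 1. *)
have -> : x = br e x - br u (bform e x * v).
  rewrite (brZr _ _ (bform_is_cent e x)) br_uv mulr1.
  by rewrite (br_trd0 _ tx) trd_e mul1r addrK.
by apply: PB.
Qed.

End Quaternion.

(** * The symmetric ring of quotients *)

Section Martindale.
Variables (R : rngType) (Q : nzRingType) (iota : R -> Q).
Hypothesis Q_sym : symmetric_quotient_ring iota.
Hypothesis R_prime : prime_rng R.
Hypothesis R_char2 : rng_pchar R 2.
Local Notation C := (extended_centroid Q).
Local Notation V := (central_closure iota).

Lemma iotaD x y : iota (x + y) = iota x + iota y. Proof. exact: sqr_add. Qed.

Lemma iotaM x y : iota (x ** y) = iota x * iota y. Proof. exact: sqr_mul. Qed.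

Lemma iota0 : iota 0 = 0.
Proof. by apply: (addIr (iota 0)); rewrite -iotaD !add0r. Qed.

Lemma iotaB x y : iota (x - y) = iota x - iota y.
Proof.
apply/eqP; rewrite eq_sym subr_eq; apply/eqP.
by rewrite -iotaD subrK.
Qed.

Lemma iota_eq0 x : iota x = 0 -> x = 0.
Proof. by rewrite -iota0; apply: sqr_inj. Qed.

Lemma iota_ad x y : iota (ad x y) = br (iota x) (iota y).
Proof. by rewrite /ad iotaB !iotaM. Qed.

Lemma nonzero_ideal_setT : nonzero_ideal [set: R].
Proof. by case: R_prime => [[x x0] _]; split; [split | exists x]. Qed.

Lemma Q_faithful_l q : (forall r, q * iota r = 0) -> q = 0.
Proof.
by move=> q0; apply: (sqr_faithful Q_sym nonzero_ideal_setT); left=> x _; apply: q0.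
Qed.

Lemma Q_char2 (q : Q) : q + q = 0.
Proof.
apply: Q_faithful_l => r; rewrite mulrDl -mulrDr -iotaD.
by case: R_char2 => _ /(_ r) + _; rewrite mulr2n => ->; rewrite iota0 mulr0.
Qed.

(** Denominators turn nonzero [a] and [b] into nonzero elements x a and b y of R, where primeness
    applies. *)
Lemma Q_prime a b : (forall r, a * iota r * b = 0) -> a = 0 \/ b = 0.
Proof.
move=> ab; apply: contrapT => /not_orP[a0 b0].
have [J Ji Ja] := sqr_denom Q_sym a; have [K Ki Kb] := sqr_denom Q_sym b.
have [x Jx xa] : exists2 x, J x & iota x * a <> 0.
  apply: contrapT => nx; apply: a0; apply: (sqr_faithful Q_sym Ji); right=> x Jx.
  by apply: contrapT => xa; apply: nx; exists x.
have [y Ky yb] : exists2 y, K y & b * iota y <> 0.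
  apply: contrapT => ny; apply: b0; apply: (sqr_faithful Q_sym Ki); left=> y Ky.
  by apply: contrapT => yb; apply: ny; exists y.
have [_ [a' _ a'E]] := Ja _ Jx; have [[b' _ b'E] _] := Kb _ Ky.
have [||] := R_prime.2 a' b'.
- move=> r; apply: iota_eq0; rewrite !iotaM a'E b'E.
  have -> : iota x * a * iota r * (b * iota y) = iota x * (a * iota r * b) * iota y.
    by rewrite !mulrA.
  by rewrite ab mulr0 mul0r.
- by move=> a'0; apply: xa; rewrite -a'E a'0 iota0.
- by move=> b'0; apply: yb; rewrite -b'E b'0 iota0.
Qed.

Lemma centraliser_iota q : (forall r, br q (iota r) = 0) -> C q.
Proof.
move=> qr; have comm r : q * iota r = iota r * q.
  by apply/eqP; rewrite -subr_eq0; apply/eqP/qr.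
apply: centP => p; apply/eqP; rewrite -subr_eq0; apply/eqP.
have [J Ji Jp] := sqr_denom Q_sym p; apply: (sqr_faithful Q_sym Ji); left=> x Jx.
have [[y _ yE] _] := Jp _ Jx.
by rewrite mulrBl -!mulrA -yE comm yE comm !mulrA subrr.
Qed.

Lemma center_iota z : rng_center R z <-> C (iota z).
Proof.
split=> [Zz|Cz x].
  by apply: centraliser_iota => r; rewrite /br -!iotaM Zz subrr.
by apply: (sqr_inj Q_sym); rewrite !iotaM (centC _ Cz).
Qed.

(** Division by [c] is a bimodule map on the ideal cJ, so completeness of [Q] realises it as
    multiplication by some [q]. *)
Lemma centroid_inv c : C c -> c <> 0 -> exists2 c', C c' & c' * c = 1.
Proof.
move=> Cc c0; have [J Ji Jc] := sqr_denom Q_sym c.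
have cinj x : c * iota x = 0 -> x = 0.
  move=> cx; apply: iota_eq0; case: (@Q_prime c (iota x)) => // r.
  by rewrite (centC _ Cc) -mulrA cx mulr0.
have [[[J0 JB] Jid] [x0 Jx0 x0n]] := Ji.
pose K : set R := [set y | exists2 x, J x & iota y = c * iota x].
have KJ y : K y -> exists x, J x /\ iota y = c * iota x.
  by case=> x Jx yE; exists x.
have Ki : nonzero_ideal K.
  split; first split; first split.
  - by exists 0 => //; rewrite iota0 mulr0.
  - move=> x y [x' Jx xE] [y' Jy yE]; exists (x' - y'); first exact: JB.
    by rewrite !iotaB mulrBr xE yE.
  - move=> x y [y' Jy yE]; split.
      exists (x ** y'); first exact: (Jid x y' Jy).1.
      by rewrite !iotaM yE (centAC _ _ Cc).
    exists (y' ** x); first exact: (Jid x y' Jy).2.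
    by rewrite !iotaM yE mulrA.
  - have [[y _ yE] _] := Jc _ Jx0; exists y; first by exists x0.
    by move=> y0; apply/x0n/cinj; rewrite -yE y0 iota0.
(* The default 0 is harmless: completeness refers only to values on [K]. *)
pose f y : R := if pselect (K y) is left Ky then projT1 (cid (KJ _ Ky)) else 0.
have fP y : K y -> J (f y) /\ iota y = c * iota (f y).
  by move=> Ky; rewrite /f; case: pselect => // Ky'; case: cid.
have f_uniq y x : K y -> iota y = c * iota x -> f y = x.
  move=> Ky yE; have [_ fE] := fP _ Ky; apply/eqP; rewrite -subr_eq0; apply/eqP/cinj.
  by rewrite iotaB mulrBr -fE yE subrr.
have [[K0 KB] Kid] := Ki.1.
have KD x y : K x -> K y -> K (x + y).
  move=> Kx Ky; rewrite -(opprK y); apply: (KB) => //.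
  by rewrite -sub0r; apply: KB.
have fD x y : K x -> K y -> f (x + y) = f x + f y.
  move=> Kx Ky; apply: f_uniq; first exact: KD.
  by rewrite !iotaD mulrDr -(fP _ Kx).2 -(fP _ Ky).2.
have [|||q qP] := sqr_complete Q_sym Ki fD fD.
- move=> x r Kx; apply: f_uniq; first exact: (Kid r x Kx).2.
  by rewrite !iotaM mulrA -(fP _ Kx).2.
- move=> x r Kx; apply: f_uniq; first exact: (Kid r x Kx).1.
  by rewrite !iotaM -(centAC _ _ Cc) -(fP _ Kx).2.
- move=> x y Kx Ky; apply: (sqr_inj Q_sym); rewrite !iotaM.
  by rewrite {1}(fP _ Ky).2 {1}(fP _ Kx).2 (centAC _ _ Cc) mulrA.
have qc : q * c = 1.
  apply/eqP; rewrite -subr_eq0; apply/eqP.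
  apply: (sqr_faithful Q_sym Ji); left=> x Jx.
  have [[y _ yE] _] := Jc _ Jx.
  have Ky : K y by exists x.
  by rewrite mulrBl mul1r -mulrA -yE (qP _ Ky).1 (f_uniq _ _ Ky yE) subrr.
exists q => //; apply: centP => x.
have cq : c * q = 1 by rewrite (centC _ Cc).
have -> : q * x = q * x * (c * q) by rewrite cq mulr1.
by rewrite mulrA -(mulrA q x c) -(centC x Cc) mulrA qc mul1r.
Qed.

(** The subspace JC of [Q]; the central closure is the case J = R. *)
Definition extension (J : set R) : set Q := @prod_set (rng_of Q) (iota @` J) C.

Lemma extension_subgroup J : @add_subgroup (rng_of Q) (extension J).
Proof.
split=> [P [[P0 _] _] //|x y Jx Jy P PG]; case: (PG) => -[_ PB] _.
by apply: PB; [apply: Jx | apply: Jy].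
Qed.

Lemma extension_gen J r c : J r -> C c -> extension J (iota r * c).
Proof. by move=> Jr Cc P [_]; apply; exists (iota r); [exists r | exists c]. Qed.

Lemma extension_ind J (P : Q -> Prop) : P 0 -> (forall x y, P x -> P y -> P (x - y)) ->
  (forall r c, J r -> C c -> P (iota r * c)) -> forall x, extension J x -> P x.
Proof.
move=> P0 PB Pg x; apply: (smallest_ind (P := P)) => //.
by move=> _ [_ [r Jr <-]] [c Cc <-]; apply: Pg.
Qed.

Lemma extension_subspace J : subspace (extension J : Q -> Prop).
Proof.
have [V0 VB] := extension_subgroup J; split=> [//|x y Vx Vy|c x Cc].
  by rewrite -(opprK y); apply: (VB) => //; rewrite -sub0r; apply: VB.
move: x; apply: extension_ind => [|x y|r k Jr Ck]; first by rewrite mulr0.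
  by rewrite mulrBr; apply: VB.
by rewrite mulrA (centC _ Cc) -mulrA; apply: extension_gen => //; apply: centM.
Qed.

Lemma extension_mul J x y : two_sided_ideal J -> V x -> extension J y ->
  extension J (x * y) /\ extension J (y * x).
Proof.
move=> [_ Jid] Vx; have [V0 VB] := extension_subgroup J.
move: y; apply: extension_ind => [|y1 y2 [l1 r1] [l2 r2]|j k Jj Ck].
- by rewrite mulr0 mul0r.
- by rewrite mulrBr mulrBl; split; apply: VB.
move: x Vx; apply: extension_ind => [|x1 x2 [l1 r1] [l2 r2]|r c _ Cc].
- by rewrite mulr0 mul0r.
- by rewrite mulrBr mulrBl; split; apply: VB.
have [Jl Jr] := Jid r j Jj.
have ac a b c1 c2 : C c1 -> iota a * c1 * (iota b * c2) = iota (a ** b) * (c1 * c2).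
  by move=> C1; rewrite iotaM -!mulrA -(centAC (iota b) c2 C1).
by rewrite !ac //; split; apply: extension_gen => //; apply: centM.
Qed.

Lemma closure_iota r : V (iota r).
Proof. by rewrite -(mulr1 (iota r)); apply: (@extension_gen setT) => //; apply: cent1. Qed.

Lemma closure_mul x y : V x -> V y -> V (x * y).
Proof.
by move=> Vx Vy; case: (@extension_mul [set: R] x y nonzero_ideal_setT.1 Vx Vy).
Qed.

Hypothesis V_dim4 : has_dim_over C V 4.

Lemma closure_basis : exists e u v, [/\ V e, V u & V v] /\
  [/\ br e u = u, br e v = v, br u v = 1 & forall x, V x -> span [:: 1; e; u; v] x].
Proof.
have [b [Vb b_span b_free]] := V_dim4; pose s := [seq b i | i <- enum 'I_4].
apply: (@sl2_basis _ V s).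
- exact: centroid_inv.
- exact: extension_subspace.
- exact: closure_mul.
- by move=> x y xy; apply: Q_prime => r; apply: xy; apply: closure_iota.
- by move=> x xV; apply: centraliser_iota => r; apply: xV; apply: closure_iota.
- by rewrite size_map size_enum_ord.
- move=> x /b_span[c [Cc ->]]; have [S0 SD SZ] := span_subspace s.
  elim/big_ind: _ => // i _; apply: SZ => //; apply: span_mem.
  by apply: map_f; rewrite mem_enum.
- exact: Q_char2.
(* If the basis were central, b_j b_i - b_i b_j = 0 would be a linear relation between two basis
   elements, forcing b_j = 0 and contradicting freeness. *)
apply: contrapT => nV; have bC i : C (b i).
  by apply: contrapT => nb; apply: nV; exists (b i).
have b0 i j : i != j -> b j = 0.
  move=> ij; have Ck k : C (if k == i then b j else if k == j then - b i else 0).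
    by case: ifP => _; [|case: ifP => _]; [|apply: centN|apply: cent0].
  have := b_free _ Ck _ i; rewrite eqxx; apply.
  rewrite (bigD1 i) //= (bigD1 j) ?(eq_sym j) //= big1 => [|k /andP[ki kj]].
    by rewrite !eqxx (negPf ij) addr0 mulNr (centC _ (bC j)) subrr.
  by rewrite (negPf ki) (negPf kj) mul0r.
pose i1 : 'I_4 := lift ord0 ord0; have b1 : b i1 = 0 by apply: (b0 ord0).
have Ck k : C (if k == i1 then 1 else 0) by case: ifP => _; [apply: cent1 | apply: cent0].
have := b_free _ Ck _ i1; rewrite eqxx => one0.
suff /one0/eqP : \sum_(i < 4) (if i == i1 then 1 else 0) * b i = 0 by rewrite oner_eq0.
by rewrite big1 // => k _; case: eqP => [->|]; rewrite ?b1 ?mulr0 ?mul0r.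
Qed.

(** Brackets with [e], [u], [v] extract the noncentral coordinates of a nonzero [j] in J. Either one
    is nonzero, or [j] is itself a nonzero scalar; dividing by it gives 1. *)
Lemma extension_unit J : nonzero_ideal J -> extension J 1.
Proof.
move=> [Ji [j Jj j0]]; have [N0 NB] := extension_subgroup J.
have [_ ND NZ] := extension_subspace J.
have [e [u [v [[Ve Vu Vv] [eu ev uv Vspan]]]]] := closure_basis.
have Nbr w x : V w -> extension J x -> extension J (br w x).
  by move=> Vw Nx; have [Nl Nr] := extension_mul Ji Vw Nx; apply: NB.
have Nunit c : C c -> c <> 0 -> extension J c -> extension J 1.
  by move=> Cc /(centroid_inv Cc)[c' Cc' <-]; apply: NZ.
have Nj : extension J (iota j).
  by rewrite -(mulr1 (iota j)); apply: extension_gen => //; apply: cent1.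
have [c1 [c2 [c3 [c4 [[C1 C2 C3 C4] jE]]]]] := span4 (Vspan _ (closure_iota j)).
have [k3 k4 k2] := sl2_coords Q_char2 eu ev uv C1 C2 C3 C4 jE.
have [c20|c20] := pselect (c2 = 0); last first.
  by apply: (Nunit _ C2 c20); rewrite -k2; apply: (Nbr _ _ Vv); apply: (Nbr _ _ Vu).
have [c30|c30] := pselect (c3 = 0); last first.
  by apply: (Nunit _ C3 c30); rewrite -k3; apply: (Nbr _ _ Vv); apply: (Nbr _ _ Ve).
have [c40|c40] := pselect (c4 = 0); last first.
  by apply: (Nunit _ C4 c40); rewrite -k4; apply: (Nbr _ _ Vu); apply: (Nbr _ _ Ve).
move: jE; rewrite c20 c30 c40 !mul0r !addr0 mulr1 => jE.
apply: (Nunit _ C1); last by rewrite -jE.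
by move=> c10; apply/j0/iota_eq0; rewrite jE.
Qed.

(** If xJ is contained in R, then x = x 1 lies in xJC, as 1 lies in JC. *)
Lemma closureT x : V x.
Proof.
have [J Ji Jx] := sqr_denom Q_sym x; have [V0 VB] := extension_subgroup [set: R].
rewrite -(mulr1 x); move: (extension_unit Ji).
apply: (extension_ind (P := fun y => V (x * y))) => [|y z|r c Jr Cc].
- by rewrite mulr0.
- by rewrite mulrBr; apply: VB.
by have [[y _ yE] _] := Jx _ Jr; rewrite mulrA -yE; apply: (@extension_gen setT).
Qed.

Lemma sl2_basisT : exists e u v : Q,
  [/\ br e u = u, br e v = v, br u v = 1 & forall x, span [:: 1; e; u; v] x].
Proof.
have [e [u [v [_ [eu ev uv Vspan]]]]] := closure_basis.
by exists e, u, v; split=> // x; apply: Vspan; apply: closureT.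
Qed.

Lemma iota_vanish (phi : Q -> Q) : (forall x y, phi (x - y) = phi x - phi y) ->
  (forall c x, C c -> phi (c * x) = c * phi x) -> (forall r, phi (iota r) = 0) ->
  forall x, phi x = 0.
Proof.
move=> phiB phiZ phi0 x; apply: (@extension_ind setT (fun y => phi y = 0)) (closureT x).
- by have := phiB 0 0; rewrite !subrr.
- by move=> y z y0 z0; rewrite phiB y0 z0 subrr.
- by move=> r c _ Cc; rewrite -(centC _ Cc) phiZ // phi0 mulr0.
Qed.

(** For [n] in J, the elements [[r1, r2], [r3, n]] lie in J and are central. If all vanished, they
    would vanish on [Q] by linearity, and [n] itself would be central. *)
Lemma ideal_center J : nonzero_ideal J -> exists z, [/\ J z, rng_center R z & z <> 0].
Proof.
move=> [[[J0 JB] Jid] [n Jn n0]]; apply: contrapT => nz.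
have [e [u [v [eu ev uv Qspan]]]] := sl2_basisT.
have Jad r x : J x -> J (ad r x) by move=> Jx; have [Jl Jr] := Jid r x Jx; apply: JB.
have r0 r1 r2 r3 : br (br (iota r1) (iota r2)) (br (iota r3) (iota n)) = 0.
  rewrite -!iota_ad; apply: contrapT => x0; apply: nz.
  exists (ad (ad r1 r2) (ad r3 n)); split; [exact: Jad (Jad _ _ Jn) | | ]; last first.
    by move=> z0; apply: x0; rewrite z0 iota0.
  by apply/center_iota; rewrite !iota_ad; apply: (br_br_cent Q_char2 eu ev uv Qspan).
have q1 r1 r2 x : br (br (iota r1) (iota r2)) (br x (iota n)) = 0.
  move: x; apply: iota_vanish => // [x y|c x Cc]; first by rewrite (brBl x) (brBr _ (br x _)).
  by rewrite (brZl _ _ Cc) (brZr _ _ Cc).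
have q2 r1 x y : br (br (iota r1) y) (br x (iota n)) = 0.
  move: y; apply: iota_vanish => // [y z|c y Cc]; first by rewrite (brBr _ y) (brBl (br _ y)).
  by rewrite (brZr _ _ Cc) (brZl _ _ Cc).
have q3 x y z : br (br z y) (br x (iota n)) = 0.
  move: z; apply: iota_vanish => // [w z|c w Cc]; first by rewrite (brBl w) (brBl (br w _)).
  by rewrite 2!(brZl _ _ Cc).
have [c1 [c2 [c3 [c4 [[C1 C2 C3 C4] nE]]]]] := span4 (Qspan (iota n)).
have [k3 k4 k2] := sl2_coords Q_char2 eu ev uv C1 C2 C3 C4 nE.
(* Since [u] and [v] are brackets, the coordinates of [n] have the form [[z, y], [x, n]]. *)
have c20 : c2 = 0 by rewrite -k2 -{1}ev q3.
have c30 : c3 = 0 by rewrite -k3 -{1}ev q3.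
have c40 : c4 = 0 by rewrite -k4 -{1}eu q3.
apply: nz; exists n; split=> //; apply/center_iota.
by rewrite nE c20 c30 c40 !mul0r !addr0 mulr1.
Qed.

Lemma common_denominator J q : nonzero_ideal J ->
  exists z r, [/\ rng_center R z, z <> 0, J r & iota z * q = iota r].
Proof.
move=> Ji; have [K Ki Kq] := sqr_denom Q_sym q.
have [z [Kz Zz z0]] := ideal_center Ki; have [w [Jw Zw w0]] := ideal_center Ji.
(* The factor [z] in K brings [q] into R, and [w] in J then brings it into J. *)
have [_ [y _ yE]] := Kq _ Kz; exists (w ** z), (w ** y).
have Cw := (center_iota w).1 Zw; have Cz := (center_iota z).1 Zz.
split.
- by apply/center_iota; rewrite iotaM; apply: centM.
- move=> wz; apply/z0/iota_eq0/(cent_cancel centroid_inv Cw).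
    by move=> /iota_eq0.
  by rewrite -iotaM wz iota0.
- by rewrite Zw; apply: (Ji.1.2 y w Jw).1.
- by rewrite !iotaM yE mulrA.
Qed.

(** * Commutator conditions on R and on its quotient ring *)

Lemma comm_set_iota J x : @comm_set R J J x ->
  @comm_set (rng_of Q) setT setT (iota x).
Proof.
move: x; apply: (smallest_ind (P := fun x => @comm_set (rng_of Q) setT setT (iota x))).
  split=> [|x y xQ yQ]; first by rewrite iota0 => P [[P0 _] _].
  rewrite iotaB => P PG; case: (PG) => -[_ PB] _.
  by apply: PB; [apply: xQ | apply: yQ].
move=> _ [a _ [b _ <-]]; rewrite iota_ad => P [_]; apply.
by exists (iota a) => //; exists (iota b).
Qed.

(* In characteristic 2 the maps in question commute with squares of central
   elements, and each [q : Q] has a multiple by a central square in J; this is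
   why a condition on [J, J] passes to [Q, Q] although the maps are not C-linear. *)
Lemma comm_condition J (phi : R -> R) (phiQ : Q -> Q) : nonzero_ideal J ->
  (forall x y, phiQ (x - y) = phiQ x - phiQ y) ->
  (forall c x, C c -> phiQ (c * c * x) = c * c * phiQ x) ->
  (forall x, phiQ (iota x) = iota (phi x)) ->
  (forall x, @comm_set R J J x -> rng_center R (phi x)) <->
  (forall x, @comm_set (rng_of Q) setT setT x -> C (phiQ x)).
Proof.
move=> Ji phiB phiZ phiE; split=> H; last first.
  by move=> x /comm_set_iota/H; rewrite phiE => /center_iota.
apply: (smallest_ind (P := fun x => C (phiQ x))).
  split=> [|x y xC yC]; first by have := phiB 0 0; rewrite !subrr => ->; apply: cent0.
  by rewrite phiB; apply: centB.
move=> _ [a _ [b _ <-]].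
have [z [r [Zz z0 Jr zE]]] := common_denominator a Ji.
have [w [s [Zw w0 Js wE]]] := common_denominator b Ji.
have Cz := (center_iota z).1 Zz; have Cw := (center_iota w).1 Zw.
(* One factor [c] clears both denominators; the second makes the multiplier a square and is absorbed
   into [r]. *)
pose c := iota z * iota w; have Cc : C c by apply: centM.
have c0 : c <> 0.
  move=> /(cent_cancel centroid_inv Cz) c0; apply/w0/iota_eq0/c0.
  by move=> /iota_eq0.
apply: (cent_divl centroid_inv (centM Cc Cc)).
  by move=> /(cent_cancel centroid_inv Cc c0).
rewrite -phiZ //.
have -> : c * c * @ad (rng_of Q) a b = iota (ad (z ** w ** r) s).
  rewrite iota_ad !iotaM -/c (brZl _ _ Cc) -zE -wE (brZl _ _ Cz) (brZr _ _ Cw).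
  by rewrite !mulrA.
rewrite phiE; apply/center_iota/H => P [_]; apply.
by exists (z ** w ** r); [apply: (Ji.1.2 _ _ Jr).1 | exists s].
Qed.

End Martindale.

Theorem theoremE (R : rngType) (Q : nzRingType) (iota : R -> Q)
    (Q_sym : symmetric_quotient_ring iota) (R_exc : exceptional iota)
    (delta d : R -> R) (deltaQ dQ : Q -> Q)
    (delta_der : derivation delta) (d_der : derivation d)
    (delta_neq0 : exists x, delta x <> 0) (d_neq0 : exists x, d x <> 0)
    (deltaQ_ext : extends_derivation iota delta deltaQ)
    (dQ_ext : extends_derivation iota d dQ)
    (I : set R) (I_ideal : nonzero_ideal I) :
  let Z := rng_center R in
  let C := extended_centroid Q in
  let RC := central_closure iota in
  let RR := @comm_set R [set: R] [set: R] in
  let II_cond := forall x, comm_set I I x -> Z (delta (d x)) in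
  (X_inner dQ -> ~ X_inner deltaQ ->
     (II_cond <-> forall x, RR x -> Z (d x))) /\
  (X_inner dQ -> X_inner deltaQ ->
     (II_cond <-> (forall x, RR x -> Z (d x)) \/
                  (forall x, RR x -> Z (delta x)))) /\
  (~ X_inner dQ -> X_inner deltaQ ->
     (II_cond <-> forall x, RR x -> Z (delta x))) /\
  (~ X_inner dQ -> ~ X_inner deltaQ ->
     (II_cond <->
      exists2 beta : R, Z beta &
        [/\ d beta <> 0, delta beta <> 0 &
         exists (g h mu : Q),
         [/\ RC g, @comm_set (rng_of Q) RC RC h & C mu] /\
         [/\ (forall x, RC x ->
                iota (delta beta) * dQ x + iota (d beta) * deltaQ x
                = @ad (rng_of Q) g x),
             (forall x, RC x -> dQ (dQ x) = mu * dQ x + @ad (rng_of Q) h x),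
             (mu = 0 <-> @comm_set (rng_of Q) RC RC g) &
             (mu <> 0 -> C (g ^+ 2 + iota (delta beta) * mu * g))]])).
Proof.
move=> Z C RC RR II_cond; have [R_prime R_char2 R_dim4] := R_exc.
have [e [u [v [eu ev uv Qs]]]] := sl2_basisT Q_sym R_prime R_char2 R_dim4.
have Cf := centroid_inv Q_sym R_prime; have c2 := Q_char2 Q_sym R_prime R_char2.
have [dlQ dlE] := deltaQ_ext; have [dQd dE] := dQ_ext.
have RCT x : RC x by apply: closureT.
have RC_setT : RC = setT by apply/predeqP => x; split.
have commE x : @comm_set (rng_of Q) RC RC x <-> trd u v x = 0.
  by rewrite RC_setT; apply: (comm_set_trd c2 eu ev uv Qs).
(* All commutator conditions become conditions on the kernel of [trd], so the ideal disappears. *)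
have sl_cond J (phi : R -> R) (phiQ : Q -> Q) : nonzero_ideal J ->
    (forall x y, phiQ (x - y) = phiQ x - phiQ y) ->
    (forall c x, C c -> phiQ (c * c * x) = c * c * phiQ x) ->
    (forall x, phiQ (iota x) = iota (phi x)) ->
    (forall x, comm_set J J x -> Z (phi x)) <->
    (forall x, trd u v x = 0 -> C (phiQ x)).
  move=> Ji phiB phiZ phiE.
  have cond := comm_condition Q_sym R_prime R_char2 R_dim4 Ji phiB phiZ phiE.
  rewrite cond; split=> H x.
    by move=> /(comm_set_trd c2 eu ev uv Qs); apply: H.
  by move=> /(comm_set_trd c2 eu ev uv Qs); apply: H.
have RT := nonzero_ideal_setT R_prime.
have IIE : II_cond <-> forall x, trd u v x = 0 -> C (deltaQ (dQ x)).
  apply: (sl_cond I (delta \o d) (deltaQ \o dQ)) => //= [x y|c x Cc|x].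
  - by rewrite (der_sub dQd) (der_sub dlQ).
  - by rewrite (der_sqr_scale _ c2 dQd Cc) (der_sqr_scale _ c2 dlQ Cc).
  - by rewrite dE dlE.
have DE : (forall x, RR x -> Z (d x)) <-> forall x, trd u v x = 0 -> C (dQ x).
  apply: sl_cond => // [x y|c x Cc]; first exact: der_sub.
  exact: der_sqr_scale.
have DlE : (forall x, RR x -> Z (delta x)) <-> forall x, trd u v x = 0 -> C (deltaQ x).
  apply: sl_cond => // [x y|c x Cc]; first exact: der_sub.
  exact: der_sqr_scale.
have comp_l := comp_cent_l Cf c2 eu ev uv Qs dQd (dl := deltaQ).
have comp_r := @comp_cent_r _ u v deltaQ dQ dlQ.
have inner_l := comp_inner_l Cf c2 eu ev uv Qs dQd (dl := deltaQ).
have inner_r := comp_inner_r Cf c2 eu ev uv Qs dlQ (d := dQ).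
(* For (i) and (iii): an X-outer derivation cannot send trace-zero elements into [C], which rules
   out one alternative. *)
have inn D : @derivation (rng_of Q) D -> (forall x, trd u v x = 0 -> C (D x)) ->
    X_inner D.
  by move=> D_der /(der_trd0_cent c2 eu ev uv Qs D_der)[a _ aE]; exists a.
rewrite IIE DE DlE; split; [|split; [|split]].
- move=> d_in dl_out; split; last exact: comp_r.
  by move=> /(inner_r d_in)[//|/(inn _ dlQ)/dl_out].
- by move=> _ dl_in; split=> [/(inner_l dl_in) []|[/comp_r|/comp_l]]; auto.
- move=> d_out dl_in; split; last exact: comp_l.
  by move=> /(inner_l dl_in)[//|/(inn _ dQd)/d_out].
move=> d_out dl_out; split=> [H|].
  have [c Cc [dc0 dlc0]] := outer_common_cent Cf c2 eu ev uv Qs dlQ dQd dl_out d_out H.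
  (* The scalar [c] need not come from R, so beta = z r = z^2 c replaces it; derivations are linear
     over the central square z^2, so both values stay nonzero. *)
  have [z [r [Zz z0 _ zE]]] :=
    common_denominator Q_sym R_prime R_char2 R_dim4 c RT.
  have Cz := (center_iota Q_sym z).1 Zz.
  have iz0 : iota z <> 0 by move=> /(iota_eq0 Q_sym).
  have betaE : iota (z ** r) = iota z * iota z * c by rewrite iotaM // -zE mulrA.
  have Cbeta : C (iota (z ** r)) by rewrite betaE; do 2?apply: centM.
  have zz0 x : iota z * iota z * x = 0 -> x = 0.
    by rewrite -mulrA => /(cent_cancel Cf Cz iz0)/(cent_cancel Cf Cz iz0).
  have dbeta : dQ (iota (z ** r)) <> 0.
    by rewrite betaE (der_sqr_scale _ c2 dQd Cz) => /zz0.
  have dlbeta : deltaQ (iota (z ** r)) <> 0.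
    by rewrite betaE (der_sqr_scale _ c2 dlQ Cz) => /zz0.
  have [g [h [mu [th Cmu [gE hE mu0 gC]]]]] :=
    comp_cent_relations Cf c2 eu ev uv Qs dlQ dQd Cbeta dlbeta H.
  rewrite dE in dbeta gE; rewrite dlE in dlbeta gE gC.
  exists (z ** r); first exact/(center_iota Q_sym).
  split.
  - by move=> b0; apply: dbeta; rewrite b0 (iota0 Q_sym).
  - by move=> b0; apply: dlbeta; rewrite b0 (iota0 Q_sym).
  exists g, h, mu; split; first by split=> //; apply/commE.
  split=> [x _|x _||_]; [exact: gE | exact: hE | by rewrite mu0 commE | by rewrite expr2].
move=> [beta Zbeta [db0 dlb0 [g [h [mu [[_ /commE th Cmu] [gE hE mu0 gC]]]]]]].
have Cbeta := (center_iota Q_sym beta).1 Zbeta.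
move=> x tx.
apply: (relations_comp_cent Cf c2 eu ev uv Qs dlQ dQd Cbeta _ th Cmu _ _ _ _ tx).
- by rewrite dE => /(iota_eq0 Q_sym).
- by move=> y; rewrite dE dlE gE.
- by move=> y; rewrite hE.
- by rewrite mu0 commE.
- by rewrite dlE -expr2.
Qed.
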